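(* Let $k\geq 1$ be an integer and $G$ a finite graph. If $\mathrm{tw}(G)\geq 2k^2-2$, then some minor of $G$ contains a $k$-block. Moreover, this bound is optimal up to a constant factor: there is an absolute constant $c>0$ such that for every sufficiently large $k$ there is a graph of tree-width at least $ck^2$ no minor of which contains a $k$-block.
   Context: For $k \in \mathbb{N}$, a set $X$ of at least $k$ vertices of $G$ is $(<\!k)$-inseparable if no two vertices of $X$ can be separated in $G$ by deleting fewer than $k$ vertices; a $k$-block is a maximal such set. $\mathrm{tw}(G)$ denotes the tree-width of $G$. *)

(* Defs.v *)
From HB Require Import structures.
From mathcomp Require Import all_boot all_order all_algebra.
From mathcomp Require Import boolp reals.

Set Implicit Arguments.
Unset Strict Implicit.
Unset Printing Implicit Defensive.

Import Order.TTheory GRing.Theory Num.Theory.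

(* Finite simple graphs; the graph without vertices is allowed. *)
Structure sgraph := SGraph {
  vertex :> finType;
  edge : rel vertex;
  edge_sym : symmetric edge;
  edge_irrefl : irreflexive edge }.

Section Connectivity.
Variable G : sgraph.
Implicit Types (A S X : {set G}) (x y : G).

Definition induced A : rel G := [rel x y | [&& x \in A, y \in A & edge x y]].

(* The empty set counts as connected; where nonemptiness matters (trees,
   branch sets) it is required separately. *)
Definition connected A : Prop := {in A &, forall x y, connect (induced A) x y}.

(* [ucycle] also accepts the closed walks x, y, x along a single edge, whence
   the bound on the length. *)
Definition acyclic : Prop := forall c : seq G, ucycle (@edge G) c -> size c < 3.

Definition is_tree : Prop := [/\ 0 < #|G|, connected [set: G] & acyclic].

Definition separates S x y : bool :=
  [&& x \notin S, y \notin S & ~~ connect (induced (~: S)) x y].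

(* (<k)-inseparable sets; x = y is harmless, as [separates S x x] is false. *)
Definition inseparable (k : nat) X : bool :=
  (k <= #|X|) &&
  [forall x in X, forall y in X, forall S : {set G},
     (#|S| < k) ==> ~~ separates S x y].

Definition kblock (k : nat) X : bool := maxset (inseparable k) X.

End Connectivity.

Section Treewidth.
Variable G : sgraph.

Definition tree_decomposition (T : sgraph) (B : T -> {set G}) : Prop :=
  [/\ is_tree T,
      forall v : G, exists t, v \in B t,
      forall u v : G, edge u v -> exists t, (u \in B t) && (v \in B t) &
      forall v : G, connected [set t | v \in B t]].

Definition max_bag (T : sgraph) (B : T -> {set G}) : nat := \max_(t : T) #|B t|.

Definition decomposable (n : nat) : Prop :=
  exists (T : sgraph) (B : T -> {set G}),
    tree_decomposition B /\ max_bag B = n.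

Fact unit_edge_sym : symmetric (fun _ _ : unit => false).
Proof. by []. Qed.

Fact unit_edge_irrefl : irreflexive (fun _ : unit => fun _ : unit => false).
Proof. by []. Qed.

Definition one_vertex_graph : sgraph := SGraph unit_edge_sym unit_edge_irrefl.

Lemma ex_decomposable : exists n, `[< decomposable n >].
Proof.
exists (@max_bag one_vertex_graph (fun=> [set: G])); apply/asboolP.
exists one_vertex_graph, (fun=> [set: G]); split=> //; split.
- split.
  + by rewrite card_unit.
  + by move=> [] [] _ _; apply: connect0.
  + by case=> [|[] [|[] [|[] c]]] //=; rewrite /ucycle.
- by move=> v; exists tt; rewrite inE.
- by move=> u v _; exists tt; rewrite !inE.
- by move=> v [] [] _ _; apply: connect0.
Qed.

(* The width of a tree-decomposition is the largest size of a bag minus 1. The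
   value is an integer since the graph without vertices has tree-width -1. *)
Definition treewidth : int := ((ex_minn ex_decomposable)%:Z - 1)%R.

End Treewidth.

(* H is a minor of G: the [phi x] are the branch sets of a model of H in G. *)
Definition minor (H G : sgraph) : Prop :=
  exists phi : H -> {set G},
    [/\ forall x, phi x != set0,
        forall x, connected (phi x),
        forall x y, x != y -> [disjoint phi x & phi y] &
        forall x y, edge x y ->
          exists u v, [/\ u \in phi x, v \in phi y & edge u v]].

(* Main.v *)
(* Upper bound. Call the boundary of a component C of G - U a mesh if no two
   k-subsets of it are separated in C (plus these subsets) by fewer than k
   vertices. A tree-decomposition of G[U] with bags of size at most 2 k^2 - 2 is
   extended one leaf bag at a time, where every component C of G - U keeps its
   boundary X inside one bag, has |X| <= h := (2 k + 1) (k - 1), and comes with a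
   connected subcubic subgraph F of G - C joining up X (degree at most 2 on X,
   at most 1 at some root r in X). While |X| < h, add a neighbour of r in C.
   If |X| = h and X is not a mesh, take a smallest set S separating subsets Y, Z
   of X and add S: a component of C - S misses Y \ S or Z \ S, say Y \ S, so
   its boundary is no larger than X, and F is prolonged along Menger paths from
   Y to S. If X is a mesh, cut F into k connected pieces with at least k vertices
   of X each; contracting them turns them into a k-block of a minor.

   Lower bound. A minor with a k-block has at least k (k - 1) / 2 edges, hence so
   has G. By counting, some graph on n = 4 q vertices with at most 124 q edges has an
   edge between any two disjoint sets of q vertices; then deleting any q vertices
   leaves a connected subgraph on more than n / 2 vertices, which forces
   tree-width at least q. Take q = k^2 / 1000. *)

Require Import Defs.
From HB Require Import structures.
From mathcomp Require Import all_boot all_order all_algebra.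
From mathcomp Require Import boolp reals zify.

Set Implicit Arguments.
Unset Strict Implicit.
Unset Printing Implicit Defensive.

Import Order.TTheory GRing.Theory Num.Theory.

(** * Linkages and Menger's theorem *)

Lemma connect_step_ind (T : finType) (e : rel T) (P : T -> Prop) (x y : T) :
  P x -> (forall u v, connect e x u -> P u -> e u v -> P v) ->
  connect e x y -> P y.
Proof.
move=> Px Pstep /connectP[p]; elim/last_ind: p y => [|p z IHp] y /=.
  by move=> _ ->.
rewrite rcons_path last_rcons => /andP[pth ez] ->.
apply: Pstep ez; last exact: IHp.
by apply/connectP; exists p.
Qed.

Lemma connect_exit (T : finType) (e : rel T) (A : {set T}) (x y : T) :
  x \in A -> y \notin A -> connect e x y ->
  exists u v, [/\ connect e x u, u \in A, v \notin A & e u v].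
Proof.
move=> xA yA cxy; apply: contrapT => noexit; move/negP: yA; apply.
apply: (connect_step_ind (P := fun v => v \in A)) cxy => // u v cxu uA euv.
by apply: contrapT => /negP vA; apply: noexit; exists u, v.
Qed.

Section Menger.
Variable V : finType.
Implicit Types (E : {set V * V}) (A B S : {set V}) (F : rel V) (u v x y : V).

Definition avoiding E S : rel V :=
  [rel u v | [&& u \notin S, v \notin S & (u, v) \in E]].

Definition reach E A S v : bool :=
  [exists a in A :\: S, connect (avoiding E S) a v].

(** [S] may meet [A] and [B]. It must contain their intersection, since a vertex of [A] outside [S]
    reaches itself. *)
Definition separator E A B S : Prop :=
  forall b, b \in B -> b \notin S -> ~~ reach E A S b.

(* A family of disjoint [A]-[B] paths is coded by the relation [F] of its
   edges; closed loops are ruled out by [linkage_from] and [linkage_to]. *)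
Record linkage E A B F : Prop := Linkage {
  linkage_sub : forall u v, F u v -> (u, v) \in E;
  linkage_fun : forall u v w, F u v -> F u w -> v = w;
  linkage_inj : forall u v w, F u w -> F v w -> u = v;
  linkage_head : forall u v, F u v -> v \notin A;
  linkage_tail : forall u v, F u v -> u \notin B;
  linkage_from : forall u v, F u v -> exists2 a, a \in A & connect F a u;
  linkage_to : forall u v, F u v -> exists2 b, b \in B & connect F v b }.

(* A vertex of [A] in [B] counts as a trivial path. *)
Definition starts A B F : {set V} :=
  [set a in A | (a \in B) || [exists v, F a v]].
Definition ends A B F : {set V} :=
  [set b in B | (b \in A) || [exists u, F u b]].

Definition rev_edges E : {set V * V} := [set e | (e.2, e.1) \in E].
Definition rev_rel F : rel V := [rel u v | F v u].

Lemma rev_edgesK E : rev_edges (rev_edges E) = E.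
Proof. by apply/setP => -[u v]; rewrite !inE. Qed.

Lemma linkage_rev E A B F :
  linkage E A B F -> linkage (rev_edges E) B A (rev_rel F).
Proof.
case=> Fs Ff Fi Fh Ft Ffr Fto; split=> /=.
- by move=> u v /Fs; rewrite inE.
- by move=> u v w uv uw; apply: Fi uv uw.
- by move=> u v w uv uw; apply: Ff uv uw.
- by move=> u v /Ft.
- by move=> u v /Fh.
- by move=> u v /Fto[b bB vb]; exists b => //; rewrite connect_rev.
- by move=> u v /Ffr[a aA av]; exists a => //; rewrite connect_rev.
Qed.

Lemma reach_notin E A S v : reach E A S v -> v \notin S.
Proof.
case/exists_inP => a; rewrite inE => /andP[aS _].
by apply: (connect_step_ind (P := fun v => v \notin S)) => // u w _ _ /and3P[].
Qed.

Lemma reach_start E A S v : v \in A -> v \notin S -> reach E A S v.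
Proof. by move=> vA vS; apply/exists_inP; exists v; rewrite ?inE ?vS. Qed.

Lemma reach_step E A S u v :
  reach E A S u -> (u, v) \in E -> v \notin S -> reach E A S v.
Proof.
move=> ru uv vS; have uS := reach_notin ru.
case/exists_inP: ru => a aA au; apply/exists_inP; exists a => //.
by apply: connect_trans au (connect1 _); apply/and3P.
Qed.

Lemma reach_ind (P : V -> Prop) E A S v :
  (forall a, a \in A -> a \notin S -> P a) ->
  (forall u w, reach E A S u -> P u -> (u, w) \in E -> w \notin S -> P w) ->
  reach E A S v -> P v.
Proof.
move=> P0 Pstep /exists_inP[a aAS av]; have := aAS; rewrite inE.
case/andP=> aS aA; apply: (connect_step_ind (P := P)) av; first exact: P0.
move=> u w au Pu /and3P[uS wS uw]; apply: (Pstep u) => //.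
by apply/exists_inP; exists a.
Qed.

(* The reversed digraph turns "reachable from [B]" into "reaches [B]". *)
Lemma separator_rev_disjoint E A B S v :
  separator E A B S -> reach E A S v -> ~~ reach (rev_edges E) B S v.
Proof.
move=> sepS rv; apply/negP => rv'.
suff: ~ reach E A S v by [].
apply: (reach_ind (P := fun v => ~ reach E A S v)) rv'.
  by move=> b bB bS; apply/negP; apply: sepS.
move=> u w ru nru wu wS rw; apply: nru; rewrite inE /= in wu.
by apply: reach_step rw wu _; apply: reach_notin ru.
Qed.

Lemma separator_rev E A B S :
  separator E A B S -> separator (rev_edges E) B A S.
Proof.
move=> sepS a aA aS; apply: separator_rev_disjoint (sepS) _.
exact: reach_start.
Qed.

(** A path of the linkage meets [D], and so [S], only in its last vertex; up to there it is a walk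
    from [A] that avoids [S]. *)
Lemma linkage_reach E A D S F u v : linkage E A D F -> S \subset D ->
  F u v -> reach E A S u /\ (v \in S \/ reach E A S v).
Proof.
move=> lF SD Fuv.
have tailS p q : F p q -> p \notin S.
  by move/(linkage_tail lF); apply: contra; apply: (subsetP SD).
have advance p q : F p q -> p \in S \/ reach E A S p ->
    reach E A S p /\ (q \in S \/ reach E A S q).
  move=> Fpq [pS|rp]; first by rewrite (negPf (tailS _ _ Fpq)) in pS.
  split=> //; case: (boolP (q \in S)) => qS; [by left | right].
  by apply: reach_step rp (linkage_sub lF Fpq) qS.
apply: (advance) => //; have [a aA au] := linkage_from lF Fuv.
apply: (connect_step_ind (P := fun u => u \in S \/ reach E A S u)) au.
  case: (boolP (a \in S)) => aS; [by left | right].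
  exact: reach_start.
by move=> p q _ rp /advance-/(_ rp)[].
Qed.

Lemma ends_sub A B F : ends A B F \subset B.
Proof. by apply/subsetP => a; rewrite inE => /andP[]. Qed.

(** Having at least as many ends as [D] has vertices, the linkage ends in every vertex of [D]. *)
Lemma linkage_ends A D F s n : n <= #|ends A D F| -> #|D| <= n -> s \in D ->
  s \in A \/ exists u, F u s.
Proof.
move=> nF Dn sD; have eqD : ends A D F = D.
  by apply/eqP; rewrite eqEcard ends_sub (leq_trans Dn nF).
move: sD; rewrite -{1}eqD inE => /andP[_] /orP[|/existsP[u]]; first by left.
by right; exists u.
Qed.

Lemma linkage_end_reach E A D S F s n : linkage E A D F -> S \subset D ->
  n <= #|ends A D F| -> #|D| <= n -> s \in D -> s \notin S -> reach E A S s.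
Proof.
move=> lF SD nF Dn sD sS.
have [sA|[u us]] := linkage_ends nF Dn sD; first exact: reach_start.
by have [_ []] := linkage_reach lF SD us; rewrite ?(negPf sS).
Qed.

Lemma linkage_end_connect E A D F s n : linkage E A D F ->
  n <= #|ends A D F| -> #|D| <= n -> s \in D ->
  exists2 a, a \in A & connect F a s.
Proof.
move=> lF nF Dn sD; have [sA|[u us]] := linkage_ends nF Dn sD.
  by exists s.
have [a aA au] := linkage_from lF us; exists a => //.
exact: connect_trans au (connect1 us).
Qed.

Lemma ends_rev A B F : ends B A (rev_rel F) = starts A B F.
Proof. by apply/setP => a; rewrite !inE. Qed.

Section Join.
Variables (E : {set V * V}) (A B S : {set V}) (x y : V) (n : nat).
Variables (F1 F2 : rel V).
Hypotheses (sepS : separator E A B S) (xS : x \notin S) (yS : y \notin S).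
Hypotheses (cardSx : #|x |: S| <= n) (cardSy : #|y |: S| <= n).
Hypotheses (lF1 : linkage E A (x |: S) F1) (lF2 : linkage E (y |: S) B F2).
Hypotheses (e1 : n <= #|ends A (x |: S) F1|).
Hypotheses (s2 : n <= #|starts (y |: S) B F2|).

(** In a vertex of [S] a path of [F1] goes over into one of [F2] by itself; only the path that ends
    in [x] needs the edge to [y]. *)
Definition join : rel V := [rel u v | [|| F1 u v, F2 u v | (u, v) == (x, y)]].

Let L1 := reach E A S.
Let L2 := reach (rev_edges E) B S.

Lemma join_from u v : join u v -> exists2 a, a \in A & connect join a u.
Proof.
have sub1 : subrel (connect F1) (connect join).
  by apply: connect_sub => p q pq; apply: connect1; rewrite /join /= pq.
have sub2 : subrel (connect F2) (connect join).
  by apply: connect_sub => p q pq; apply: connect1; rewrite /join /= pq orbT.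
have fromS s : s \in x |: S -> exists2 a, a \in A & connect join a s.
  move=> sD; have [a aA as_] := linkage_end_connect lF1 e1 cardSx sD.
  by exists a => //; apply: sub1.
case/or3P => [uv|uv|/eqP[-> _]].
- by have [a aA au] := linkage_from lF1 uv; exists a => //; apply: sub1.
- have [s] := linkage_from lF2 uv; rewrite in_setU1 => /orP[/eqP->|sS] su.
    have [|a aA ax] := fromS x; first by rewrite setU11.
    exists a => //; apply: connect_trans ax _.
    apply: connect_trans (sub2 _ _ su).
    by apply: connect1; rewrite /join /= eqxx !orbT.
  have [|a aA ax] := fromS s; first by rewrite in_setU1 sS orbT.
  by exists a => //; apply: connect_trans ax (sub2 _ _ su).
- by apply: fromS; rewrite setU11.
Qed.

Lemma join_disjoint v : L1 v -> L2 v -> False.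
Proof. by move=> v1 v2; move/negP: (separator_rev_disjoint sepS v1). Qed.

Lemma join_tail1 u v : F1 u v -> L1 u.
Proof. by move/(linkage_reach lF1 (subsetUr _ _)) => []. Qed.

Lemma join_head1 u v : F1 u v -> v \in S \/ L1 v.
Proof. by move/(linkage_reach lF1 (subsetUr _ _)) => []. Qed.

Lemma join_head2 u v : F2 u v -> L2 v.
Proof.
by move=> uv; have [] := linkage_reach (linkage_rev lF2) (subsetUr _ _)
  (uv : rev_rel F2 v u).
Qed.

Lemma join_tail2 u v : F2 u v -> u \in S \/ L2 u.
Proof.
by move=> uv; have [] := linkage_reach (linkage_rev lF2) (subsetUr _ _)
  (uv : rev_rel F2 v u).
Qed.

Lemma join_L1x : L1 x.
Proof.
by apply: linkage_end_reach lF1 _ e1 cardSx _ xS; rewrite ?subsetUr ?setU11.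
Qed.

Lemma join_L2y : L2 y.
Proof.
apply: (linkage_end_reach (linkage_rev lF2)) cardSy _ yS => //.
- exact: subsetUr.
- exact: setU11.
Qed.

End Join.

Lemma join_rev x y F1 F2 :
  join y x (rev_rel F2) (rev_rel F1) =2 rev_rel (join x y F1 F2).
Proof.
by move=> u v; rewrite /join /rev_rel /= !xpair_eqE orbCA [(u == y) && _]andbC.
Qed.

(** [F1] runs on the [A]-side of [S] until its paths end, [F2] on the [B]-side once its paths have
    started. As the sides are disjoint, the two meet only in [S], where paths of [F1] end and paths
    of [F2] begin. *)
Lemma linkage_join E A B S x y n F1 F2 :
  separator E A B S -> x \notin S -> y \notin S ->
  #|x |: S| <= n -> #|y |: S| <= n ->
  linkage E A (x |: S) F1 -> linkage E (y |: S) B F2 ->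
  n <= #|ends A (x |: S) F1| -> n <= #|starts (y |: S) B F2| ->
  linkage ((x, y) |: E) A B (join x y F1 F2) /\
  starts A (x |: S) F1 \subset starts A B (join x y F1 F2).
Proof.
move=> sepS xS yS cx cy l1 l2 e1 s2.
have dis := join_disjoint sepS.
have t1 := join_tail1 l1; have h1 := join_head1 l1.
have t2 := join_tail2 l2; have h2 := join_head2 l2.
have Lx := join_L1x xS cx l1 e1; have Ly := join_L2y yS cy l2 s2.
have notS D w : reach D A S w -> w \notin S by apply: reach_notin.
have notS2 D w : reach D B S w -> w \notin S by apply: reach_notin.
have t12 u v w : F1 u v -> F2 u w -> False.
  move=> /t1 Lu /t2 [uS|]; last exact: dis.
  by move/notS: Lu; rewrite uS.
have h12 u v w : F1 u w -> F2 v w -> False.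
  move=> /h1[wS|Lw] /h2; last exact: dis.
  by move/notS2; rewrite wS.
have ne1x v : F1 x v -> False.
  by move/(linkage_tail l1); rewrite setU11.
have ne1y u : F1 u y -> False.
  by case/h1 => [yS'|/dis-/(_ Ly)//]; rewrite yS' in yS.
have ne2y u : F2 u y -> False.
  by move/(linkage_head l2); rewrite setU11.
have ne2x v : F2 x v -> False.
  by case/t2 => [xS'|]; [rewrite xS' in xS | apply: dis].
split; last first.
  apply/subsetP => a; rewrite !inE => /andP[aA]; rewrite aA /=.
  case/orP => [/orP[/eqP->|aS]|/existsP[v av]].
  - by apply/orP; right; apply/existsP; exists y; rewrite /join /= eqxx !orbT.
  - have : n <= #|ends B (y |: S) (rev_rel F2)| by rewrite ends_rev.
    move/linkage_ends => /(_ a cy); rewrite in_setU1 aS orbT => /(_ isT)[-> //|].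
    move=> [v av]; apply/orP; right; apply/existsP; exists v.
    by rewrite /join /= (av : is_true (F2 a v)) orbT.
  - by apply/orP; right; apply/existsP; exists v; rewrite /join /= av.
split.
- move=> u v /or3P[/(linkage_sub l1)|/(linkage_sub l2)|/eqP->].
  + by rewrite in_setU1 orbC => ->.
  + by rewrite in_setU1 orbC => ->.
  + by rewrite setU11.
- move=> u v w /or3P[uv|uv|/eqP[-> ->]] /or3P[uw|uw|/eqP[]].
  + exact: linkage_fun l1 _ _ _ uv uw.
  + by have := t12 _ _ _ uv uw.
  + by move=> eu; rewrite eu in uv; have := ne1x _ uv.
  + by have := t12 _ _ _ uw uv.
  + exact: linkage_fun l2 _ _ _ uv uw.
  + by move=> eu; rewrite eu in uv; have := ne2x _ uv.
  + by have := ne1x _ uw.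
  + by have := ne2x _ uw.
  + by [].
- move=> u v w /or3P[uv|uv|/eqP[-> ew]] /or3P[uw|uw|/eqP[]].
  + exact: linkage_inj l1 _ _ _ uv uw.
  + by have := h12 _ _ _ uv uw.
  + by move=> _ ew; rewrite ew in uv; have := ne1y _ uv.
  + by have := h12 _ _ _ uw uv.
  + exact: linkage_inj l2 _ _ _ uv uw.
  + by move=> _ ew; rewrite ew in uv; have := ne2y _ uv.
  + by rewrite ew in uw; have := ne1y _ uw.
  + by rewrite ew in uw; have := ne2y _ uw.
  + by [].
- have nA v : reach (rev_edges E) B S v -> v \notin A.
    move=> Lv; apply/negP => vA; apply: (dis v) => //.
    by apply: reach_start => //; apply: reach_notin Lv.
  move=> u v /or3P[/(linkage_head l1)//|/h2/nA//|/eqP[_ ->]].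
  exact: nA.
- have nB v : reach E A S v -> v \notin B.
    move=> Lv; apply/negP => vB; apply: (dis v) => //.
    by apply: reach_start => //; apply: reach_notin Lv.
  move=> u v /or3P[/t1/nB//|/(linkage_tail l2)//|/eqP[-> _]].
  exact: nB.
- exact: (join_from cx l1 l2 e1).
(* The last condition is [join_from] in the reversed digraph. *)
- move=> u v uv.
  have s2' : n <= #|ends B (y |: S) (rev_rel F2)| by rewrite ends_rev.
  have vu : join y x (rev_rel F2) (rev_rel F1) v u by rewrite join_rev; exact: uv.
  have [b bB bv] := join_from cy (linkage_rev l2) (linkage_rev l1) s2' vu.
  by exists b => //; move: bv; rewrite (eq_connect (join_rev _ _ _ _)) connect_rev.
Qed.

(** A walk in [E] from [A] avoiding [Q] never enters [D]: up to its first vertex in [D] it would use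
    edges of [E'] only. Staying off [D], it stays off [S] too, so [S] keeps it from [B]. *)
Lemma separator_tighten E E' A B S (D : {set V}) Q : S \subset D ->
  (forall u w, (u, w) \in E -> u \notin D -> (u, w) \in E') ->
  separator E' A B S -> separator E' A D Q -> separator E A B Q.
Proof.
move=> /subsetP SD subE sepS sepQ b bB bQ; apply/negP => rb.
pose P v := reach E' A S v && reach E' A Q v && (v \notin D).
suff /andP[/andP[rSb _]] : P b.
  move=> bD; have bS : b \notin S by apply: contra bD; apply: SD.
  by move/negP: (sepS b bB bS).
have PQ v : reach E' A Q v -> (v \notin S -> reach E' A S v) -> P v.
  move=> rQ rS; have vD : v \notin D.
    by apply/negP => /sepQ/(_ (reach_notin rQ))/negP.
  by rewrite /P rQ vD !andbT rS //; apply: contra vD; apply: SD.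
apply: (reach_ind (P := P)) rb => [a aA aQ|u w _ /andP[/andP[rS rQ] uD] uw wQ].
  by apply: PQ; [apply: reach_start | move=> aS; apply: reach_start].
have uw' := subE u w uw uD.
by apply: PQ; [apply: reach_step rQ uw' wQ | apply: reach_step rS uw'].
Qed.

(* Göring's proof: if deleting the edge [x y] creates a separator [S] of size
   less than [n], link [A] to [x |: S] and [y |: S] to [B]. *)
Theorem Menger E A B n :
  (forall S, separator E A B S -> n <= #|S|) ->
  exists F, [/\ linkage E A B F, n <= #|starts A B F| & n <= #|ends A B F|].
Proof.
move: {2}#|E| (leqnn #|E|) => m; elim: m => [|m IHm] in E A B *.
  rewrite leqn0 cards_eq0 => /eqP-> sepn.
  (* Without edges the intersection separates, and its vertices are the trivial paths required. *)
  have sepAB : separator set0 A B (A :&: B).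
    move=> b bB bAB; apply/negP => rb; suff: b \in A :&: B by rewrite (negPf bAB).
    rewrite inE bB andbT; apply: (reach_ind (P := fun v => v \in A)) rb => //.
    by move=> u w _ _; rewrite inE.
  have nAB := sepn _ sepAB; exists (fun _ _ => false); split.
  - by split.
  - by apply: leq_trans nAB (subset_leq_card _); apply/subsetP => a;
      rewrite !inE => /andP[-> ->].
  - by apply: leq_trans nAB (subset_leq_card _); apply/subsetP => a;
      rewrite !inE => /andP[-> ->].
move=> Em sepn; have [E0|[[x y] xyE]] := set_0Vmem E.
  by apply: IHm sepn; rewrite E0 cards0.
pose E' := E :\ (x, y).
have cE' : #|E'| <= m by rewrite -ltnS (leq_trans _ Em) // [ltnRHS](cardsD1 (x, y)) xyE.
have [sepn'|] := pselect (forall S, separator E' A B S -> n <= #|S|).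
  have [F [lF sF eF]] := IHm _ _ _ cE' sepn'.
  exists F; split=> //; case: lF => Fs *; split=> // u v /Fs.
  by rewrite inE => /andP[].
move/existsNP => [S /not_implyP[sepS /negP]]; rewrite -ltnNge => Sn.
(* [E] and [E'] differ only in an edge that leaves [x |: S], so tightening applies: every set
   separating [A] from [x |: S] in [E'] has at least [n] elements. *)
have sepx Q : separator E' A (x |: S) Q -> separator E A B Q.
  apply: separator_tighten (subsetUr _ _) _ sepS => u w uw.
  by rewrite in_setU1 negb_or => /andP[ux _]; rewrite !inE uw xpair_eqE (negPf ux).
have revE' : rev_edges E' = rev_edges E :\ (y, x).
  by apply/setP => -[u v]; rewrite !inE /= !xpair_eqE [(v == x) && _]andbC.
have sepy Q : separator E' (y |: S) B Q -> separator E A B Q.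
  move=> /separator_rev sepQ; rewrite -[E]rev_edgesK; apply: separator_rev.
  apply: separator_tighten (subsetUr _ _) _ (separator_rev sepS) sepQ => u w uw.
  rewrite in_setU1 negb_or revE' => /andP[uy _].
  by rewrite in_setD1 uw xpair_eqE (negPf uy).
have notS z : separator E A B (z |: S) -> z \notin S.
  by move=> /sepn; rewrite cardsU1; case: (z \in S); rewrite // leqNgt Sn.
(* [x |: S] separates [A] from itself, hence [A] from [B] in [E]; so it has at least [n] elements,
   while [S] has fewer. *)
have xS : x \notin S by apply/notS/sepx => b bD bS; rewrite bD in bS.
have yS : y \notin S.
  apply/notS/sepy => b _ _; rewrite /reach setDv.
  by apply/exists_inP => -[a]; rewrite inE.
have cx : #|x |: S| <= n by rewrite cardsU1 xS.
have cy : #|y |: S| <= n by rewrite cardsU1 yS.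
have [F1 [l1 s1 e1]] := IHm E' A (x |: S) cE' (fun Q sQ => sepn Q (sepx Q sQ)).
have [F2 [l2 s2 e2]] := IHm E' (y |: S) B cE' (fun Q sQ => sepn Q (sepy Q sQ)).
have [lF starts1] := linkage_join sepS xS yS cx cy l1 l2 e1 s2.
have [_ ends2] := linkage_join (separator_rev sepS) yS xS cy cx (linkage_rev l2)
  (linkage_rev l1) s2 e1.
exists (join x y F1 F2); split.
- by move: lF; rewrite setD1K.
- exact: leq_trans s1 (subset_leq_card starts1).
- apply: leq_trans e2 (subset_leq_card _).
  rewrite -[ends _ _ F2]/(starts B (y |: S) (rev_rel F2)); apply: subset_trans ends2 _.
  apply/subsetP => v; rewrite !inE => /andP[->] /orP[->//|/existsP[u]].
  by rewrite join_rev => vu; apply/orP; right; apply/existsP; exists u.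
Qed.

End Menger.

(** * Cutting subcubic graphs into connected pieces *)

Lemma card_bigcup_leq (I T : finType) (P : pred I) (A : I -> {set T}) K :
  (forall i, P i -> #|A i| <= K) -> #|\bigcup_(i | P i) A i| <= #|P| * K.
Proof.
move=> AK; rewrite -sum_nat_const; elim/big_rec2: _ => [|i a B Pi IH].
  by rewrite cards0.
exact: leq_trans (leq_card_setU _ _).1 (leq_add (AK i Pi) IH).
Qed.

Section Splitting.
Variables (V : finType) (F : rel V).
Hypothesis F_sym : symmetric F.
Implicit Types (A D W X : {set V}) (u v r : V).

Definition within A : rel V := [rel u v | [&& u \in A, v \in A & F u v]].

Definition conn A : Prop := {in A &, forall u v, connect (within A) u v}.

Lemma within_sym A : symmetric (within A).
Proof. by move=> u v; rewrite /within /= F_sym andbCA. Qed.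

Lemma connect_withinC A u v : connect (within A) u v = connect (within A) v u.
Proof. exact: sym_connect_sym (within_sym A) u v. Qed.

Lemma within_mono A D : A \subset D -> subrel (connect (within A)) (connect (within D)).
Proof.
move=> /subsetP AD; apply: connect_sub => u v /and3P[uA vA uv].
by apply: connect1; rewrite /within /= !AD.
Qed.

Lemma conn_center A r : r \in A -> {in A, forall v, connect (within A) r v} -> conn A.
Proof.
move=> rA ctr u v uA vA; apply: connect_trans (ctr v vA).
by rewrite connect_withinC ctr.
Qed.

Definition component A u : {set V} := [set v | connect (within A) u v].

Lemma component_sub A u : u \in A -> component A u \subset A.
Proof.
move=> uA; apply/subsetP => v; rewrite inE.
by apply: (connect_step_ind (P := fun v => v \in A)) => // x y _ _ /and3P[].
Qed.

Lemma component_refl A u : u \in component A u.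
Proof. by rewrite inE connect0. Qed.

Lemma component_conn A u : conn (component A u).
Proof.
apply: (@conn_center _ u); first exact: component_refl.
move=> v; rewrite inE.
apply: (connect_step_ind (P := fun v => connect (within (component A u)) u v)) => //.
move=> x y ux ux' xy; apply: connect_trans ux' (connect1 _).
by rewrite /within /= !inE ux (connect_trans ux (connect1 xy)); case/and3P: xy.
Qed.

Lemma component_eq A u v : v \in component A u -> component A v = component A u.
Proof.
rewrite inE => uv; apply/setP => w; rewrite !inE.
by rewrite (same_connect (sym_connect_sym (within_sym A)) uv).
Qed.

(** Deleting [r] leaves at most two components. If one of them has [k] vertices of [X], recurse into
    it, with the neighbour of [r] as new root; otherwise [W] itself has at most 1 + 2 (k - 1)
    vertices of [X]. *)
Lemma split_off k X W r :
  0 < k -> r \in W -> conn W ->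
  {in W, forall v, #|[set u in W | F v u]| <= 3} ->
  #|[set u in W | F r u]| <= 2 -> k <= #|W :&: X| ->
  exists D, [/\ D \subset W, conn D, k <= #|D :&: X|, #|D :&: X| < k.*2 &
    D = W \/ r \in W :\: D /\ conn (W :\: D)].
Proof.
move=> k0; move: {2}#|W| (leqnn #|W|) => m; elim: m => [|m IHm] in W r *.
  by rewrite leqn0 cards_eq0 => /eqP->; rewrite inE.
move=> Wm rW cW deg3 deg2 kW.
pose N := [set u in W :\ r | F r u]; pose K := component (W :\ r).
have NW u : u \in N -> u \in W :\ r by rewrite inE => /andP[].
have KW u : u \in N -> K u \subset W :\ r by move=> /NW/component_sub.
have cover v : v \in W -> v = r \/ exists2 u, u \in N & v \in K u.
  move=> vW; pose P v := v = r \/ exists2 u, u \in N & v \in K u.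
  apply: (connect_step_ind (P := P)) (cW r v rW vW); first by left.
  move=> x y _ Px /and3P[xW yW xy]; case: (eqVneq y r) => [|yr]; first by left.
  right; case: Px => [xr|[u uN xK]].
    by exists y; rewrite ?component_refl // !inE yr yW -xr.
  exists u => //; have := subsetP (KW u uN) x xK; rewrite !inE => /andP[xr _].
  rewrite inE in xK; apply: connect_trans xK (connect1 _).
  by rewrite /within /= !inE xr yr xW yW.
have cN : #|N| <= 2.
  apply: leq_trans (subset_leq_card _) deg2; apply/subsetP => u.
  by rewrite !inE => /andP[/andP[_ ->]].
have [/exists_inP[u uN kK]|/exists_inPn small] :=
    boolP [exists u in N, k <= #|K u :&: X|]; last first.
  exists W; split=> //; last by left.
  have: W :&: X \subset r |: \bigcup_(u in N) (K u :&: X).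
    apply/subsetP => v; rewrite !inE => /andP[/cover[->|[u uN vK]] vX].
      by rewrite eqxx.
    by apply/orP; right; apply/bigcupP; exists u; rewrite // inE vK.
  move=> /subset_leq_card/leq_ltn_trans; apply.
  apply: leq_ltn_trans (leq_card_setU _ _).1 _; rewrite cards1.
  have le : #|\bigcup_(u in N) (K u :&: X)| <= #|N| * k.-1.
    by apply: card_bigcup_leq => u uN; rewrite -ltnS prednK // ltnNge small.
  have := leq_trans le (leq_mul cN (leqnn k.-1)); lia.
have rK : r \notin K u.
  by apply/negP => /(subsetP (KW u uN)); rewrite !inE eqxx.
have KW' : K u \subset W by apply: subset_trans (KW u uN) (subsetDl _ _).
have ruF : F r u by move: uN; rewrite inE => /andP[].
have Km : #|K u| <= m.
  rewrite -ltnS (leq_trans _ Wm) //; apply: proper_card; apply/properP.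
  by split=> //; exists r.
have K3 : {in K u, forall v, #|[set w in K u | F v w]| <= 3}.
  move=> v vK; apply: leq_trans (subset_leq_card _) (deg3 v (subsetP KW' v vK)).
  by apply/subsetP => w; rewrite !inE => /andP[wK ->]; rewrite (subsetP KW') ?inE.
(* [u] has lost its neighbour [r], hence the bound 2 at the new root. *)
have K2 : #|[set w in K u | F u w]| <= 2.
  have := deg3 u (subsetP KW' u (component_refl _ _)).
  rewrite (cardsD1 r) inE rW F_sym ruF add1n ltnS; apply: leq_trans.
  apply: subset_leq_card; apply/subsetP => w; rewrite !(inE, in_setD1).
  case/andP=> wK ->; rewrite (subsetP KW') ?inE //; case: eqP => // wr.
  by rewrite -wr inE wK in rK.
have [D [DK cD kD Dk Dr]] :=
  IHm (K u) u Km (component_refl _ _) (@component_conn _ _) K3 K2 kK.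
exists D; split=> //; first exact: subset_trans DK KW'.
have rD : r \in W :\: D.
  by rewrite inE rW andbT; apply: contra rK; apply: (subsetP DK).
(* The rest hangs together at [r]: components other than [K u] are untouched, and what [D] leaves of
   [K u], if anything, is connected and contains [u]. *)
right; split=> //; apply: (conn_center rD) => v; rewrite inE => /andP[vD vW].
have toN w : w \in N -> w \notin D -> connect (within (W :\: D)) r w.
  move=> wN wD; have := NW w wN; rewrite in_setD1 => /andP[_ wW].
  apply: connect1; apply/and3P; split=> //; first by rewrite inE wD.
  by move: wN; rewrite inE => /andP[].
have [->|[w wN vKw]] := cover v vW; first exact: connect0.
case: (boolP (v \in K u)) => vKu.
  case: Dr => [DKu|[uD cDK]]; first by rewrite DKu vKu in vD.
  have uD' : u \notin D by move: uD; rewrite inE => /andP[].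
  apply: connect_trans (toN u uN uD') _.
  apply: within_mono (cDK u v uD _); first exact: setSD.
  by rewrite inE vD.
have KwD : K w \subset W :\: D.
  apply/subsetP => z zK; rewrite inE; apply/andP; split; last first.
    by have := subsetP (KW w wN) z zK; rewrite inE => /andP[].
  apply: contra vKu => /(subsetP DK) zKu.
  by rewrite /K -(component_eq zKu) (component_eq zK).
apply: connect_trans (toN w wN _) _.
  by have := subsetP KwD w (component_refl _ _); rewrite inE => /andP[].
by apply: within_mono KwD _ _ _; apply: component_conn => //; apply: component_refl.
Qed.

(** What [split_off] leaves is connected and keeps the root [r], so cutting can go on. Each piece
    uses up at most 2k - 1 vertices of [X], and the last one needs [k]. *)
Lemma split_many k j X W r :
  0 < k -> r \in W -> conn W ->
  {in W, forall v, #|[set u in W | F v u]| <= 3} ->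
  #|[set u in W | F r u]| <= 2 -> k.*2.-1 * j + k <= #|W :&: X| ->
  exists D : 'I_j.+1 -> {set V},
    [/\ forall i, D i \subset W, forall i, conn (D i),
        forall i, k <= #|D i :&: X| &
        forall i i', i != i' -> [disjoint D i & D i']].
Proof.
move=> k0; elim: j => [|j IHj] in W *.
  rewrite muln0 => rW cW _ _ kW; exists (fun=> W); split=> // i i'.
  by rewrite (ord1 i) (ord1 i').
move=> rW cW deg3 deg2 kW.
have [|D0 [DW cD kD Dk Dr]] := split_off k0 rW cW deg3 deg2 (X := X).
  by apply: leq_trans kW; rewrite leq_addl.
case: Dr => [D0W|[rD cWD]].
  have : k.*2 <= #|W :&: X|.
    by apply: leq_trans kW; rewrite mulnS; move: (_ * j) => b; lia.
  by rewrite -{1}D0W leqNgt Dk.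
have [| | |D [DWD cDs kDs disD]] := IHj (W :\: D0) rD cWD.
- move=> v /setDP[vW _]; apply: leq_trans (subset_leq_card _) (deg3 v vW).
  by apply/subsetP => u; rewrite !inE => /andP[/andP[_ ->] ->].
- apply: leq_trans (subset_leq_card _) deg2.
  by apply/subsetP => u; rewrite !inE => /andP[/andP[_ ->] ->].
- have : #|W :&: X| <= #|D0 :&: X| + #|(W :\: D0) :&: X|.
    apply: leq_trans (leq_card_setU _ _).1; apply: subset_leq_card.
    by apply/subsetP => v; rewrite !inE => /andP[-> ->]; case: (v \in D0).
  by move: kW Dk; rewrite mulnS; move: (_ * j) => b; lia.
have dis0 i : [disjoint D0 & D i].
  rewrite -setI_eq0; apply/eqP/setP => v; rewrite !inE.
  case: (boolP (v \in D i)) => [/(subsetP (DWD i))|]; last by rewrite andbF.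
  by rewrite inE => /andP[/negPf->].
exists (fun i => if unlift ord0 i is Some i' then D i' else D0); split.
- move=> i; case: unliftP => [i' _|_] //.
  exact: subset_trans (DWD i') (subsetDl _ _).
- by move=> i; case: unliftP.
- by move=> i; case: unliftP.
- move=> i i'; case: unliftP => [a ->|->]; case: unliftP => [b ->|->] //.
  + by rewrite (inj_eq (lift_inj (h := ord0))) => ab; apply: disD.
  + by rewrite disjoint_sym.
Qed.

End Splitting.

(** * Meshes and their extension *)

Section Mesh.
Variable G : sgraph.
Implicit Types (C S X Y Z : {set G}) (F : rel G).

Definition boundary C : {set G} :=
  [set x | (x \notin C) && [exists c in C, edge x c]].

Lemma boundaryP C x :
  reflect (x \notin C /\ exists2 c, c \in C & edge x c) (x \in boundary C).
Proof.
by rewrite inE; apply: (iffP andP) => -[xC /exists_inP ?].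
Qed.

(* [F] spans a subcubic connected subgraph of [G - C] containing the boundary
   of [C], with room for a path into [C] at each boundary vertex, and even for
   one more at [r]. *)
Record premesh C F (r : G) : Prop := Premesh {
  premesh_sym : symmetric F;
  premesh_edge : forall u v, F u v -> edge u v;
  premesh_out : forall u v, F u v -> u \notin C;
  premesh_root : r \in boundary C;
  premesh_conn : forall x, x \in boundary C -> connect F r x;
  premesh_deg3 : forall v, #|[set u | F v u]| <= 3;
  premesh_deg2 : forall v, v \in boundary C -> #|[set u | F v u]| <= 2;
  premesh_deg1 : #|[set u | F r u]| <= 1 }.

(** Each edge occurs in both directions, since Menger's theorem is stated for digraphs. *)
Definition hull_edges C Y Z : {set G * G} :=
  [set e | [&& e.1 \in C :|: Y :|: Z, e.2 \in C :|: Y :|: Z & edge e.1 e.2]].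

Definition mesh k C : Prop := forall Y Z S,
  Y \subset boundary C -> Z \subset boundary C -> k <= #|Y| -> k <= #|Z| ->
  separator (hull_edges C Y Z) Y Z S -> k <= #|S|.

Section Contraction.
Variables (I : finType) (phi : I -> {set G}).

Definition contraction_edge : rel I :=
  [rel p q | (p != q) && [exists u in phi p, exists v in phi q, edge u v]].

Lemma contraction_sym : symmetric contraction_edge.
Proof.
move=> p q; rewrite /contraction_edge /= eq_sym; congr (_ && _).
by apply/exists_inP/exists_inP => -[u ? /exists_inP[v ? uv]];
  exists v => //; apply/exists_inP; exists u => //; rewrite edge_sym.
Qed.

Lemma contraction_irrefl : irreflexive contraction_edge.
Proof. by move=> p; rewrite /contraction_edge /= eqxx. Qed.

Definition contraction := SGraph contraction_sym contraction_irrefl.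

Lemma contraction_minor :
  (forall p, phi p != set0) -> (forall p, connected (phi p)) ->
  (forall p q, p != q -> [disjoint phi p & phi q]) -> minor contraction G.
Proof.
move=> phi0 cphi dphi; exists phi; split=> // p q /andP[_ /exists_inP[u up]].
by case/exists_inP=> v vq uv; exists u, v.
Qed.

End Contraction.

(** The branch sets are [k] pieces cut from [F] and the single vertices of [C]. Two pieces contain
    [k] boundary vertices each, and the mesh property joins these through [C] so well that fewer
    than [k] vertices cannot separate the pieces. *)
Lemma mesh_kblock k C F r : 0 < k -> premesh C F r -> mesh k C ->
  k.*2.-1 * k.-1 + k <= #|boundary C| ->
  exists H : sgraph, minor H G /\ exists X : {set H}, kblock k X.
Proof.
move=> k0 [Fsym Fedge Fout rX Fconn deg3 deg2 deg1] meshC kC.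
pose W := component F [set: G] r.
have WE v : (v \in W) = connect F r v.
  by rewrite inE; apply: eq_connect => x y; rewrite /within /= !inE.
have XW : boundary C \subset W by apply/subsetP => x /Fconn; rewrite WE.
have degW v : #|[set u in W | F v u]| <= #|[set u | F v u]|.
  by apply: subset_leq_card; apply/subsetP => u; rewrite !inE => /andP[].
have CW v : v \in W -> v \notin C.
  rewrite WE; apply: (connect_step_ind (P := fun v => v \notin C)).
    by case/boundaryP: rX.
  by move=> u w _ _; rewrite Fsym; apply: Fout.
have W3 : {in W, forall v, #|[set u in W | F v u]| <= 3}.
  by move=> v _; apply: leq_trans (degW v) (deg3 v).
have W2 : #|[set u in W | F r u]| <= 2.
  by apply: leq_trans (degW r) (leq_trans deg1 _).
have kX : k.*2.-1 * k.-1 + k <= #|W :&: boundary C| by rewrite (setIidPr XW).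
have [D [DW cD kD disD]] := split_many Fsym k0 (subsetP XW r rX)
  (component_conn Fsym (A := setT) (u := r)) W3 W2 kX.
have DC i v : v \in D i -> v \notin C by move/(subsetP (DW i))/CW.
pose phi (p : 'I_k.-1.+1 + {x | x \in C}) : {set G} :=
  match p with inl i => D i | inr x => [set val x] end.
have phi_inj p q v : v \in phi p -> v \in phi q -> p = q.
  case: p q => [i|x] [i'|x'] /=.
  - move=> vi vi'; case: (eqVneq i i') => [->//|/disD].
    by rewrite disjoint_subset => /subsetP/(_ v vi); rewrite inE vi'.
  - by move=> /DC + /set1P eqv; rewrite eqv (valP x').
  - by move=> /set1P eqv /DC; rewrite eqv (valP x).
  - by move=> /set1P-> /set1P/val_inj->.
exists (contraction phi); split.
  apply: contraction_minor => [[i|x]|[i|x]|p q pq].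
  - apply/set0Pn; have /card_gt0P[v] := leq_trans k0 (kD i).
    by rewrite inE => /andP[vD _]; exists v.
  - by apply/set0Pn; exists (val x); rewrite set11.
  - move=> u v uD vD; move: (cD i u v uD vD); apply: connect_sub => a b.
    case/and3P=> aD bD /Fedge ab; apply: connect1.
    by apply/and3P.
  - by move=> u v /set1P-> /set1P->; apply: connect0.
  - rewrite -setI_eq0; apply/eqP/setP => v; rewrite in_setI in_set0.
    apply/negP => /andP[vp vq]; case/eqP: pq; exact: phi_inj vp vq.
pose X := [set p : contraction phi | if p is inl _ then true else false].
have [|B /maxsetP[insB maxB] _] := @maxset_exists _ (inseparable k) X; last first.
  by exists B; apply/maxsetP.
apply/andP; split.
  have cX : #|[set (inl i : contraction phi) | i in [set: 'I_k.-1.+1]]| = k.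
    by rewrite card_imset ?cardsT ?card_ord ?prednK // => i i' [].
  rewrite -{1}cX; apply: subset_leq_card; apply/subsetP => _ /imsetP[i _ ->].
  by rewrite inE.
apply/forall_inP => -[a _|x]; last by rewrite inE.
apply/forall_inP => -[b _|x]; last by rewrite inE.
apply/forallP => S; apply/implyP => Sk; apply/negP => /and3P[aS bS /negP]; apply.
(* Only the singletons in [S] matter: walks in the hull stay in [C] and the pieces [a] and [b],
   which are not in [S]. *)
pose S0 := [set val x | x in [set x : {x | x \in C} | inr x \in S]].
have S0k : #|S0| < k.
  apply: leq_ltn_trans Sk; rewrite card_imset; last exact: val_inj.
  rewrite -(card_imset (f := fun x => inr x : contraction phi)).
    apply: subset_leq_card; apply/subsetP => _ /imsetP[x xS ->].
    by move: xS; rewrite inE.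
  by move=> x y [].
have YX i : D i :&: boundary C \subset boundary C by apply: subsetIr.
have /existsNP[v] :
    ~ separator (hull_edges C (D a :&: boundary C) (D b :&: boundary C))
        (D a :&: boundary C) (D b :&: boundary C) S0.
  by move/(meshC _ _ _ (YX a) (YX b) (kD a) (kD b)); rewrite leqNgt S0k.
rewrite not_implyE => -[vb]; rewrite not_implyE => -[vS0 /negP].
rewrite negbK => rv.
(* A walk in the hull that avoids [S0] projects to a walk in the contraction that avoids [S]. *)
pose P v := exists p : contraction phi,
  [/\ v \in phi p, p \notin S & connect (induced (~: S)) (inl a) p].
suff [p [vp pS cp]] : P v.
  by rewrite (phi_inj (inl b) p v) //; move: vb; rewrite inE => /andP[].
apply: (reach_ind (P := P)) rv => [u|u w _ [p [up pS cp]] + wS0].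
  by rewrite inE => /andP[uD _] _; exists (inl a).
rewrite inE /= => /and3P[_ wC uw].
have [q wq qS] : exists2 q : contraction phi, w \in phi q & q \notin S.
  move: wC; rewrite !in_setU => /orP[/orP[wC|]|].
  - exists (inr (Sub w wC)); first by rewrite /= inE.
    apply: contra wS0 => wS; apply/imsetP; exists (Sub w wC) => //.
    by rewrite inE.
  - by rewrite inE => /andP[wD _]; exists (inl a).
  - by rewrite inE => /andP[wD _]; exists (inl b).
exists q; split=> //; case: (eqVneq p q) => [<-//|pq].
apply: connect_trans cp (connect1 _); apply/and3P; split; rewrite ?inE //.
apply/andP; split=> //; apply/exists_inP; exists u => //.
by apply/exists_inP; exists w.
Qed.

End Mesh.

(** * Passing a premesh on to a component left inside C *)

Section Extension.
Variable G : sgraph.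
Implicit Types (C Q S U X Y Z : {set G}) (F L : rel G).

(** These conditions describe the components of G - U. *)
Definition free_component U C : Prop :=
  [/\ C != set0, C \subset ~: U, connected C &
      forall u v, u \in C -> v \notin U -> edge u v -> v \in C].

Lemma free_boundary U C : free_component U C -> boundary C \subset U.
Proof.
case=> _ _ _ clC; apply/subsetP => x /boundaryP[xC [c cC xc]].
by apply: contraNT xC => xU; apply: clC cC xU _; rewrite edge_sym.
Qed.

Section Refinement.
Variables U C Q C' : {set G}.
Hypotheses (compC : free_component U C) (QC : Q \subset C).
Hypotheses (compC' : free_component (Q :|: U) C') (C'C : C' \subset C).

Lemma refine_notinQ v : v \in C' -> v \notin Q.
Proof.
case: compC' => _ /subsetP C'U _ _ /C'U.
by rewrite !inE negb_or => /andP[].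
Qed.

Lemma refine_closed u v : u \in C' -> v \in C -> v \notin Q -> edge u v -> v \in C'.
Proof.
case: compC' => _ _ _ clC' uC' vC vQ; apply: clC' => //.
case: compC => _ /subsetP/(_ v vC) + _ _.
by rewrite !inE negb_or vQ.
Qed.

Lemma refine_boundary : boundary C' \subset boundary C :|: Q.
Proof.
apply/subsetP => x /boundaryP[xC' [c cC' xc]]; rewrite inE.
case: (boolP (x \in Q)) => xQ; first by rewrite orbT.
rewrite orbF; apply/boundaryP; split; last by exists c => //; apply: (subsetP C'C).
apply: contra xC' => xC; apply: refine_closed cC' xC xQ _.
by rewrite edge_sym.
Qed.

(** As [C] is connected, a path in [C] from [C'] to [Q] has to leave [C'], and it can do so only
    into [Q]. *)
Lemma refine_contact : Q != set0 -> exists2 s, s \in Q & s \in boundary C'.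
Proof.
case/set0Pn => q qQ; case: compC => _ _ cC _; case: compC' => /set0Pn[c cC'] _ _ _.
have qC' : q \notin C' by apply/negP => /refine_notinQ; rewrite qQ.
have := cC c q (subsetP C'C c cC') (subsetP QC q qQ).
case/(connect_exit cC' qC') => u [v [_ uC' vC' /and3P[_ vC uv]]].
have vQ : v \in Q by apply: contraNT vC' => vQ; apply: refine_closed uC' vC vQ uv.
by exists v => //; apply/boundaryP; split=> //; exists u; rewrite // edge_sym.
Qed.

End Refinement.

(** The new edge from [r] to [u] uses up the spare degree at [r]; [u], now a leaf and on the
    boundary of [C'], becomes the root. *)
Lemma premesh_add_vertex U C F r u C' :
  free_component U C -> premesh C F r -> u \in C -> edge r u ->
  free_component (u |: U) C' -> C' \subset C ->
  exists F' r', premesh C' F' r'.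
Proof.
move=> compC [Fsym Fedge Fout rX Fconn deg3 deg2 deg1] uC ru compC' C'C.
have uC1 : [set u] \subset C by rewrite sub1set.
have [|_ /set1P-> uX'] := refine_contact compC uC1 compC' C'C.
  by apply/set0Pn; exists u; rewrite set11.
have rC : r \notin C by case/boundaryP: rX.
have ur : u != r by apply: contraNneq rC => <-.
have Fu v : F v u = false by apply/negP; rewrite Fsym => /Fout; rewrite uC.
pose F' : rel G := [rel a b | [|| F a b, (a == r) && (b == u) | (a == u) && (b == r)]].
have F'sym : symmetric F'.
  by move=> a b; rewrite /F' /= Fsym [(b == r) && _]andbC [(b == u) && _]andbC
    orbC [X in _ = _ || X]orbC orbC.
have FF' : subrel (connect F) (connect F').
  by apply: connect_sub => a b ab; apply: connect1; rewrite /F' /= ab.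
have degu : #|[set v | F' u v]| <= 1.
  rewrite -(cards1 r); apply: subset_leq_card; apply/subsetP => v.
  by rewrite !inE /F' /= Fsym Fu (negPf ur) eqxx.
have degr v : v != u -> v != r -> #|[set w | F' v w]| <= #|[set w | F v w]|.
  move=> vu vr; apply: subset_leq_card; apply/subsetP => w.
  by rewrite !inE /F' /= (negPf vu) (negPf vr) !orbF.
have degr2 : #|[set w | F' r w]| <= 2.
  have sub : [set w | F' r w] \subset u |: [set w | F r w].
    apply/subsetP => w; rewrite !inE /F' /= eqxx [r == u]eq_sym (negPf ur) orbF.
    by rewrite orbC.
  apply: leq_trans (subset_leq_card sub) _; rewrite cardsU1.
  exact: leq_add (leq_b1 _) deg1.
exists F', u; split=> //.
- move=> a b /or3P[/Fedge//|/andP[/eqP-> /eqP->]//|/andP[/eqP-> /eqP->]].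
  by rewrite edge_sym.
- have uC' : u \notin C' by case/boundaryP: uX'.
  move=> a b /or3P[/Fout|/andP[/eqP-> _]|/andP[/eqP-> _]//].
    by apply: contra; apply: (subsetP C'C).
  by apply: contra rC; apply: (subsetP C'C).
- move=> x /(subsetP (refine_boundary compC compC' C'C)).
  rewrite in_setU => /orP[xX|/set1P->]; last exact: connect0.
  apply: connect_trans (FF' _ _ (Fconn x xX)).
  by apply: connect1; rewrite /F' /= !eqxx !orbT.
- move=> v; case: (eqVneq v u) => [->|vu]; first exact: leq_trans degu _.
  case: (eqVneq v r) => [->|vr]; first exact: leq_trans degr2 _.
  exact: leq_trans (degr v vu vr) (deg3 v).
- move=> v /(subsetP (refine_boundary compC compC' C'C)).
  rewrite in_setU => /orP[vX|/set1P->]; last exact: leq_trans degu _.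
  case: (eqVneq v u) => [->|vu]; first exact: leq_trans degu _.
  case: (eqVneq v r) => [->|vr]; first exact: degr2.
  exact: leq_trans (degr v vu vr) (deg2 v vX).
Qed.

Lemma premesh_single U C u C' : free_component U C -> boundary C = set0 ->
  u \in C -> free_component (u |: U) C' -> C' \subset C ->
  exists F' r', premesh C' F' r'.
Proof.
move=> compC X0 uC compC' C'C.
have uC1 : [set u] \subset C by rewrite sub1set.
have [|_ /set1P-> uX'] := refine_contact compC uC1 compC' C'C.
  by apply/set0Pn; exists u; rewrite set11.
have deg0 : #|[set w : G | false]| = 0.
  by apply/eqP; rewrite cards_eq0; apply/eqP/setP => w; rewrite !inE.
exists (fun _ _ => false), u; split=> // [x|v|v _|]; rewrite /= ?deg0 //.
move=> /(subsetP (refine_boundary compC compC' C'C)).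
by rewrite X0 set0U => /set1P->; apply: connect0.
Qed.

Section Linking.
Variables (U C Y Z S C' : {set G}) (F : rel G) (r : G).
Hypotheses (compC : free_component U C) (preF : premesh C F r).
Hypothesis YX : Y \subset boundary C.
Let Q := S :&: C.
Hypotheses (compC' : free_component (Q :|: U) C') (C'C : C' \subset C).
Hypotheses (Q0 : Q != set0).
Let E := hull_edges C Y Z.
Hypothesis sepS : separator E Y Z S.
Hypothesis minS : forall S', separator E Y Z S' -> #|S| <= #|S'|.
Hypothesis noY : forall y, y \in Y -> y \notin S -> y \notin boundary C'.

Let QC : Q \subset C. Proof. exact: subsetIr. Qed.

Let XC x : x \in boundary C -> x \notin C. Proof. by case/boundaryP. Qed.

(** By [noY] no vertex of [Y] outside [S] has a neighbour in [C'], and within [C] one can enter [C']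
    only from [S]. *)
Lemma link_reach v : reach E Y S v -> v \notin C' /\ (v \in Y \/ v \in C).
Proof.
apply: (reach_ind (P := fun v => v \notin C' /\ (v \in Y \/ v \in C))).
  move=> y yY yS; split; last by left.
  by apply/negP => /(subsetP C'C); apply/negP/XC/(subsetP YX).
move=> u w ru [uC' uYC] uw wS.
have [wV euw] : w \in C :|: Y :|: Z /\ edge u w by move: uw; rewrite inE => /and3P[].
have rw := reach_step ru uw wS; split.
  apply/negP => wC'; case: uYC => [uY|uC].
    move/negP: (noY uY (reach_notin ru)); apply.
    by apply/boundaryP; split=> //; exists w.
  move/negP: uC'; apply; apply: (refine_closed compC compC' wC' uC).
    by rewrite inE negb_and (reach_notin ru).
  by rewrite edge_sym.
move: wV; rewrite !in_setU => /orP[/orP[]|wZ]; [by right | by left |].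
by have := sepS wZ wS; rewrite rw.
Qed.

(** By [noY] the new boundary lies in the old one without [Y], plus [S]. *)
Lemma linkedset_card : #|S| < #|Y| -> #|boundary C'| <= #|boundary C|.
Proof.
move=> SY; have sub : boundary C' \subset (boundary C :\: Y) :|: S.
  apply/subsetP => x xX'; rewrite in_setU in_setD; case: (boolP (x \in S)) => xS.
    by rewrite orbT.
  rewrite orbF; apply/andP; split; first by apply: contraL xX' => /noY; apply.
  have := subsetP (refine_boundary compC compC' C'C) x xX'.
  by rewrite !inE (negPf xS) /= orbF.
apply: leq_trans (subset_leq_card sub) _.
apply: leq_trans (leq_card_setU _ _).1 _.
rewrite -[leqRHS](cardsID Y) (setIidPr YX) addnC leq_add2r.
exact: ltnW.
Qed.

(** Prolong [F] along disjoint paths from [Y] to [S]. A vertex of [Y] outside [S] may gain an edge,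
    but it leaves the boundary, where degree 3 is allowed. The vertices of [Q] are ends of paths and
    have degree at most 1, so any of them on the new boundary can be the root. *)
Lemma premesh_link : exists F' r', premesh C' F' r'.
Proof.
have [Fsym Fedge Fout rX Fconn deg3 deg2 deg1] := preF.
(* A set separating [Y] from [S] also separates [Y] from [Z], so by the choice of [S] it is no
   smaller than [S]. *)
have [S' sepS'|L [linkL _ endsL]] := @Menger _ E Y S #|S|.
  by apply: minS; apply: separator_tighten sepS sepS'.
have Lreach u v : L u v -> reach E Y S u by case/(linkage_reach linkL (subxx S)).
have Lhead u v : L u v -> v \notin S -> v \in C.
  move=> uv vS; have [_ [vS'|/link_reach[_ [vY|//]]]] :=
    linkage_reach linkL (subxx S) uv; first by rewrite vS' in vS.
  by move/negP: (linkage_head linkL uv).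
have LS u v : L u v -> u \notin S by move/(linkage_tail linkL).
have Ledge u v : L u v -> edge u v.
  by move/(linkage_sub linkL); rewrite inE => /and3P[].
have QS v : v \in Q -> v \in S by rewrite inE => /andP[].
have C'S v : v \in S -> v \notin C'.
  move=> vS; apply/negP => vC'; move/negP: (refine_notinQ compC' vC').
  by apply; rewrite inE vS (subsetP C'C).
(* Edges that end outside [C] are left out, lest they raise degrees there; only the paths to [Q] are
   needed. *)
pose L' : rel G := [rel u v | L u v && (v \in C)].
pose F' : rel G := [rel u v | [|| F u v, L' u v | L' v u]].
have out1 u : #|[set v | L u v]| <= 1.
  apply/card_le1_eqP => v w; rewrite !inE.
  by move=> uv uw; rewrite (linkage_fun linkL uv uw).
have in1 u : #|[set v | L v u]| <= 1.
  apply/card_le1_eqP => v w; rewrite !inE.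
  by move=> uv uw; rewrite (linkage_inj linkL uv uw).
have FC u v : u \in C -> F u v = false.
  by move=> uC; apply/negP => /Fout; rewrite uC.
have degC v : v \in C -> #|[set w | F' v w]| <= 2.
  move=> vC; apply: leq_trans (_ : #|[set w | L v w] :|: [set w | L w v]| <= _).
    apply: subset_leq_card; apply/subsetP => w; rewrite !inE /F' /= FC //=.
    by case/orP => /andP[-> _]; rewrite ?orbT.
  exact: leq_trans (leq_card_setU _ _).1 (leq_add (out1 v) (in1 v)).
have degQ v : v \in Q -> #|[set w | F' v w]| <= 1.
  rewrite inE => /andP[vS vC]; apply: leq_trans (in1 v).
  apply: subset_leq_card; apply/subsetP => w; rewrite !inE /F' /= FC //=.
  by case/orP => /andP[] // /LS; rewrite vS.
have degX v : v \in boundary C -> v \notin Y :\: S ->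
    #|[set w | F' v w]| <= #|[set w | F v w]|.
  move=> /XC vC; rewrite in_setD negb_and negbK => vYS.
  apply: subset_leq_card; apply/subsetP => w; rewrite !inE /F' /L' /= (negPf vC).
  rewrite andbF orbF => /orP[//|/andP[vw _]].
  have [_ [vY|vC']] := link_reach (Lreach _ _ vw); last by rewrite vC' in vC.
  by case/orP: vYS => [vS|/negP//]; move: (LS _ _ vw); rewrite vS.
have degY v : v \notin C -> #|[set w | F' v w]| <= #|[set w | F v w]|.+1.
  move=> vC; apply: leq_trans (_ : #|[set w | F v w] :|: [set w | L v w]| <= _).
    apply: subset_leq_card; apply/subsetP => w; rewrite !inE /F' /L' /= (negPf vC).
    by rewrite andbF orbF => /orP[->//|/andP[-> _]]; rewrite orbT.
  by apply: leq_trans (leq_card_setU _ _).1 _; rewrite -addn1 leq_add2l.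
have degN v : v \notin C -> v \notin boundary C ->
    #|[set w | F' v w]| <= #|[set w | F v w]|.
  move=> vC vX; apply: subset_leq_card; apply/subsetP => w.
  rewrite !inE /F' /L' /= (negPf vC) andbF orbF => /orP[//|/andP[vw _]].
  have [_ [vY|vC']] := link_reach (Lreach _ _ vw); last by rewrite vC' in vC.
  by rewrite (subsetP YX) in vX.
have F'sym : symmetric F'.
  by move=> u v; rewrite /F' /= Fsym [(L u v && _) || _]orbC.
have FF' : subrel (connect F) (connect F').
  by apply: connect_sub => a b ab; apply: connect1; rewrite /F' /= ab.
have LF' : subrel (connect L') (connect F').
  by apply: connect_sub => a b ab; apply/connect1/or3P/Or32.
have connQ s : s \in Q -> connect F' r s.
  rewrite inE => /andP[sS sC].
  have [y yY ys] := linkage_end_connect linkL endsL (leqnn _) sS.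
  apply: connect_trans (FF' _ _ (Fconn y (subsetP YX y yY))) (LF' _ _ _).
  (* An edge of [L] that ends outside [C] ends in [S], where its path stops; so the path to [s],
     which lies in [C], survives in [L']. *)
  suff [//|[_]] : connect L' y s \/ s \in S /\ s \notin C by rewrite sC.
  pose P v := connect L' y v \/ v \in S /\ v \notin C.
  apply: (connect_step_ind (P := P)) ys; first by left.
  move=> u v _ [yu|[uS _]] uv; last by move: (LS _ _ uv); rewrite uS.
  case: (boolP (v \in C)) => vC.
    by left; apply: connect_trans yu (connect1 _); rewrite /L' /= uv.
  by right; split=> //; apply: contraNT vC => /(Lhead _ _ uv).
have [s sQ sX'] := refine_contact compC QC compC' C'C Q0.
have bound := subsetP (refine_boundary compC compC' C'C).
exists F', s; split=> //.
- move=> u v /or3P[/Fedge//|/andP[/Ledge//]|/andP[/Ledge]].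
  by rewrite edge_sym.
- move=> u v /or3P[/Fout|/andP[/Lreach/link_reach[]]//|/andP[vu _]].
    by apply: contra; apply: (subsetP C'C).
  by have [_ [/C'S|/link_reach[]]] := linkage_reach linkL (subxx S) vu.
- move=> x /bound; rewrite in_setU (sym_connect_sym F'sym) => xXQ.
  have rx : connect F' r x by case/orP: xXQ => [/Fconn/FF'|/connQ].
  by rewrite (sym_connect_sym F'sym) (connect_trans _ rx) // (sym_connect_sym F'sym) connQ.
- move=> v; case: (boolP (v \in C)) => vC; first exact: leq_trans (degC v vC) _.
  case: (boolP (v \in boundary C)) => vX; last exact: leq_trans (degN v vC vX) (deg3 v).
  exact: leq_trans (degY v vC) (deg2 v vX : _ < 3).
- move=> v vX'; have := bound v vX'; rewrite in_setU => /orP[vX|vQ].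
    apply: leq_trans (degX v vX _) (deg2 v vX).
    by apply/negP => /setDP[vY vS]; move/negP: (noY vY vS).
  exact: leq_trans (degQ v vQ) _.
- exact: degQ.
Qed.

End Linking.

End Extension.

(** * Assembling tree-decompositions *)

Section AddLeaf.
Variables (T : sgraph) (t0 : T).

Definition leaf_edge : rel (option T) := fun a b =>
  match a, b with
  | Some x, Some y => edge x y
  | Some x, None => x == t0
  | None, Some y => y == t0
  | None, None => false
  end.

Lemma leaf_sym : symmetric leaf_edge.
Proof. by move=> [x|] [y|] //=; rewrite edge_sym. Qed.

Lemma leaf_irrefl : irreflexive leaf_edge.
Proof. by case=> //= x; rewrite edge_irrefl. Qed.

Definition add_leaf := SGraph leaf_sym leaf_irrefl.

(** The last hypothesis allows [A] to consist of the new leaf alone. *)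
Lemma add_leaf_connected (A0 : {set T}) (A : {set add_leaf}) :
  (forall t, (Some t \in A) = (t \in A0)) -> connected A0 ->
  (forall t, None \in A -> t \in A0 -> t0 \in A0) -> connected A.
Proof.
move=> AE cA0 A0t.
have lift a b : Some a \in A -> Some b \in A -> connect (induced A) (Some a) (Some b).
  rewrite !AE => aA bA; have := cA0 a b aA bA.
  apply: (connect_step_ind (P := fun b => connect (induced A) (Some a) (Some b))).
    exact: connect0.
  move=> u v _ au /and3P[]; rewrite -!AE => uA vA uv.
  by apply: connect_trans au (connect1 _); apply/and3P.
have A0t' t : None \in A -> Some t \in A -> Some t0 \in A by rewrite !AE; apply: A0t.
case=> [a|] [b|] aA bA; [exact: lift | | | exact: connect0].
- have t0A := A0t' a bA aA; apply: connect_trans (lift _ _ aA t0A) (connect1 _).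
  by apply/and3P; split=> //=.
- have t0A := A0t' b aA bA; apply: connect_trans (connect1 _) (lift _ _ t0A bA).
  by apply/and3P; split=> //=.
Qed.

Lemma add_leaf_tree : is_tree T -> is_tree add_leaf.
Proof.
case=> T0 cT acT; split.
- by rewrite card_option.
- by apply: add_leaf_connected cT _ => [t|t _]; rewrite !inE.
(* Rotated to start at [None], a cycle has [Some t0] both second and last, hence at most two
   vertices. A cycle that misses [None] is one of [T]. *)
- move=> c uc; case: (boolP (None \in c)) => [/rot_to[i p rotc]|Nc].
    rewrite -(size_rot i) rotc; have: ucycle leaf_edge (rot i c) by rewrite rot_ucycle.
    rewrite rotc; case: p rotc => // -[t|] // p _; rewrite /ucycle /= => /andP[].
    case/andP=> /eqP-> + /andP[_ /andP[tp up]].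
    case: (lastP p) tp up => // p' y; rewrite mem_rcons inE negb_or rcons_path.
    case/andP=> ty _ _ /andP[_]; rewrite last_rcons; case: y ty => //= y.
    by move=> ne /eqP eqy; rewrite eqy eqxx in ne.
  have cE : c = map some (pmap id c).
    elim: c Nc {uc} => //= -[x|] c IH; rewrite inE //= => Nc; by congr (_ :: _); apply: IH.
  move: (pmap id c) cE => c' cE; rewrite cE size_map; apply: acT; move: uc.
  by rewrite cE /ucycle (map_inj_uniq (@Some_inj _)) cycle_map.
Qed.

End AddLeaf.

Section Assembly.
Variables (G : sgraph) (w : nat) (good : {set G} -> Prop).
Implicit Types (C Q U : {set G}).

Record partial_decomposition U (T : sgraph) (B : T -> {set G}) : Prop := {
  partial_tree : is_tree T;
  partial_bag : forall t, B t \subset U;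
  partial_cover : forall v, v \in U -> exists t, v \in B t;
  partial_edge : forall u v, u \in U -> v \in U -> edge u v ->
    exists t, (u \in B t) && (v \in B t);
  partial_conn : forall v, connected [set t | v \in B t];
  partial_width : forall t, #|B t| <= w }.

(** The neighbours in [U] of a vertex of [Q] are on the boundary of [C], so the new bag covers all
    new edges. It meets old bags only within [boundary C], which is contained in the bag at [t0]. *)
Lemma partial_step U C Q (T : sgraph) (B : T -> {set G}) t0 :
  partial_decomposition U B -> free_component U C -> boundary C \subset B t0 ->
  Q \subset C -> #|boundary C :|: Q| <= w ->
  partial_decomposition (Q :|: U)
    (fun t : add_leaf t0 => if t is Some t' then B t' else boundary C :|: Q).
Proof.
case=> treeT BU Bcov Bedge Bconn Bw compC Ct0 QC Qw.
have XU := free_boundary compC; case: compC => _ CU _ _.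
have QU v : v \in Q -> v \notin U.
  by move=> /(subsetP QC)/(subsetP CU); rewrite inE.
have Qedge u v : u \in Q -> v \in Q :|: U -> edge u v -> v \in boundary C :|: Q.
  move=> uQ; rewrite !in_setU => /orP[->|vU uv]; first by rewrite orbT.
  apply/orP; left; apply/boundaryP; split.
    by apply/negP => /(subsetP CU); rewrite inE vU.
  by exists u; rewrite 1?edge_sym // (subsetP QC).
split.
- exact: add_leaf_tree.
- case=> [t|]; first exact: subset_trans (BU t) (subsetUr _ _).
  by rewrite subUset subsetUl (subset_trans XU (subsetUr _ _)).
- move=> v; rewrite in_setU => /orP[vQ|/Bcov[t vt]]; last by exists (Some t).
  by exists None; rewrite in_setU vQ orbT.
- move=> u v uQU vQU uv; case: (boolP (u \in Q)) => uQ.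
    by exists None; rewrite (Qedge u v) // in_setU uQ orbT.
  case: (boolP (v \in Q)) => vQ.
    by exists None; rewrite (Qedge v u) // 1?edge_sym // in_setU vQ orbT.
  move: uQU vQU; rewrite !in_setU (negPf uQ) (negPf vQ) /= => uU vU.
  by have [t uvt] := Bedge u v uU vU uv; exists (Some t).
- move=> v; apply: add_leaf_connected (Bconn v) _ => [t|t]; first by rewrite !inE.
  rewrite [None \in _]inE in_setU [t \in _]inE [t0 \in _]inE => /orP[vX _|/QU vU /(subsetP (BU t))].
    exact: (subsetP Ct0).
  by rewrite (negPf vU).
- by case.
Qed.

Hypothesis good_start : forall C, free_component set0 C -> good C.
Hypothesis good_step : forall U C, free_component U C -> good C ->
  exists Q, [/\ Q \subset C, Q != set0, #|boundary C :|: Q| <= w &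
    forall C', free_component (Q :|: U) C' -> C' \subset C -> good C'].

(** Deleting a subset of [C] breaks up only [C] and leaves the other components of G - U alone. *)
Lemma free_component_split U C Q C' : free_component U C -> Q \subset C ->
  free_component (Q :|: U) C' -> C' \subset C \/ free_component U C'.
Proof.
move=> [C0 CU cC clC] QC [C'0 C'U cC' clC'].
have C'U' v : v \in C' -> v \notin U.
  by move/(subsetP C'U); rewrite !inE negb_or => /andP[].
have [/existsP[x /andP[xC' xC]]|/existsPn noCC'] := boolP [exists x, (x \in C') && (x \in C)].
  left; apply/subsetP => y yC'; apply: contraT => yC.
  have [u [v [_ uC vC /and3P[uC' vC' uv]]]] := connect_exit xC yC (cC' x y xC' yC').
  by rewrite (clC u v uC (C'U' v vC') uv) in vC.
right; split=> //; first by apply/subsetP => v /C'U'; rewrite inE.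
move=> u v uC' vU uv; apply: (clC' u v) => //; rewrite in_setU negb_or vU andbT.
apply/negP => /(subsetP QC) vC; have := noCC' u; rewrite uC' (clC v u vC) //.
  exact: C'U'.
by rewrite edge_sym.
Qed.

Lemma component_free U v : v \notin U ->
  free_component U (component (@edge G) (~: U) v).
Proof.
move=> vU; have vC := component_refl (@edge G) (~: U) v; split.
- by apply/set0Pn; exists v.
- by apply: component_sub; rewrite inE.
- exact: component_conn (@edge_sym G) _ _.
- move=> x y; rewrite !inE => vx yU xy; apply: (connect_trans vx (connect1 _)).
  have vU' : v \in ~: U by rewrite inE.
  have xC : x \in component (@edge G) (~: U) v by rewrite inE.
  have xU := subsetP (component_sub (@edge G) vU') x xC.
  by apply/and3P; split=> //; rewrite inE.
Qed.

(** Induction on the number of vertices outside [U], where every component of G - U is good and has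
    its boundary inside one bag. For the new components within [C] that bag is the new leaf. *)
Lemma exists_decomposition :
  exists (T : sgraph) (B : T -> {set G}), tree_decomposition B /\ max_bag B <= w.
Proof.
suff [T [B dB]] : exists (T : sgraph) (B : T -> {set G}), partial_decomposition setT B.
  case: dB => treeT BU Bcov Bedge Bconn Bw; exists T, B; split; last exact/bigmax_leqP.
  by split=> // [v|u v]; [apply: Bcov | apply: Bedge].
suff ext m U (T : sgraph) (B : T -> {set G}) : #|~: U| <= m -> partial_decomposition U B ->
    (forall C, free_component U C -> good C /\ exists t, boundary C \subset B t) ->
    exists (T : sgraph) (B : T -> {set G}), partial_decomposition setT B.
  apply: (ext _ set0 one_vertex_graph (fun=> set0) (leqnn _)).
    split=> [|t|v|u v|v a b|t]; rewrite ?sub0set ?cards0 ?inE //.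
    split; first by rewrite card_unit.
    - by move=> [] [] _ _; apply: connect0.
    - by case=> [|[] [|[] [|[] c]]] //=; rewrite /ucycle.
  move=> C compC; split; first exact: good_start.
  by exists tt; apply: free_boundary.
elim: m => [|m IHm] in U T B *.
  rewrite leqn0 cards_eq0 => /eqP U0 dB _; exists T, B.
  by rewrite -[setT]setC0 -U0 setCK in dB *.
move=> Um dB goodU; have [U0|[v]] := set_0Vmem (~: U).
  by apply: (IHm U T B) => //; rewrite U0 cards0.
rewrite inE => /component_free; set C := component _ _ _ => compC.
have [goodC [t0 Ct0]] := goodU C compC.
have [Q [QC Q0 Qw goodQ]] := good_step compC goodC.
apply: (IHm (Q :|: U)) (partial_step dB compC Ct0 QC Qw) _.
  rewrite -ltnS (leq_trans _ Um) //; apply: proper_card; apply/properP; split.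
    by apply/subsetP => x; rewrite !inE negb_or => /andP[].
  case/set0Pn: Q0 => q qQ; exists q; last by rewrite !inE qQ.
  by case: compC => _ /subsetP CU _ _; apply/CU/(subsetP QC).
move=> C' compC'; case: (free_component_split compC QC compC') => [C'C|compUC'].
  split; first exact: goodQ.
  by exists None; apply: refine_boundary compC compC' C'C.
by have [goodC' [t C't]] := goodU C' compUC'; split=> //; exists (Some t).
Qed.

End Assembly.

Lemma treewidth_le (G T : sgraph) (B : T -> {set G}) n :
  tree_decomposition B -> max_bag B <= n -> (treewidth G <= n%:Z - 1)%R.
Proof.
move=> dB Bn; rewrite /treewidth; case: ex_minnP => m _ minm.
have /minm mB : `[< decomposable G (max_bag B) >] by apply/asboolP; exists T, B.
by rewrite lerD2r lez_nat (leq_trans mB).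
Qed.

(** * Small separators and the upper bound *)

Section Treewidth.
Variable G : sgraph.
Implicit Types (C Q S U X Y Z D : {set G}).

Lemma hull_edgesC C Y Z : hull_edges C Z Y = hull_edges C Y Z.
Proof. by rewrite /hull_edges setUAC. Qed.

Lemma rev_hull_edges C Y Z : rev_edges (hull_edges C Y Z) = hull_edges C Y Z.
Proof. by apply/setP => -[u v]; rewrite !inE /= edge_sym andbCA. Qed.

Lemma hull_separatorC C Y Z S :
  separator (hull_edges C Y Z) Y Z S -> separator (hull_edges C Z Y) Z Y S.
Proof. by move/separator_rev; rewrite rev_hull_edges hull_edgesC. Qed.

(** Otherwise a walk from [y] to [z] through the connected set [D] would avoid [S]. *)
Lemma hull_through C D Y Z S y z : separator (hull_edges C Y Z) Y Z S ->
  D \subset C -> connected D -> [disjoint D & S] ->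
  y \in Y -> y \notin S -> y \in boundary D ->
  z \in Z -> z \notin S -> z \notin boundary D.
Proof.
move=> sepS DC cD DS yY yS /boundaryP[_ [c cD1 yc]] zZ zS.
apply/negP => /boundaryP[_ [d dD zd]]; move/negP: (sepS z zZ zS); apply.
have DV v : v \in D -> v \in C :|: Y :|: Z.
  by move=> /(subsetP DC) vC; rewrite !in_setU vC.
have DnS v : v \in D -> v \notin S by move=> vD; rewrite (disjointFr DS vD).
have rc : reach (hull_edges C Y Z) Y S c.
  apply: reach_step (reach_start _ yY yS) _ (DnS c cD1).
  by rewrite inE /= (DV c cD1) !in_setU yY orbT yc.
suff rd : reach (hull_edges C Y Z) Y S d.
  apply: reach_step rd _ zS.
  by rewrite inE /= (DV d dD) !in_setU zZ orbT edge_sym zd.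
apply: (connect_step_ind (P := reach (hull_edges C Y Z) Y S)) (cD c d cD1 dD) => //.
move=> u v _ ru /and3P[uD vD uv]; apply: reach_step ru _ (DnS v vD).
by rewrite inE /= !DV.
Qed.

Lemma exists_minimum_separator (E : {set G * G}) Y Z S :
  separator E Y Z S -> exists S', [/\ separator E Y Z S', #|S'| <= #|S| &
    forall S'', separator E Y Z S'' -> #|S'| <= #|S''|].
Proof.
move=> /asboolP sepS.
case: (@arg_minnP _ S (fun S => `[< separator E Y Z S >]) (fun S => #|S|) sepS).
move=> S' /asboolP sepS' minS'; exists S'; split=> //; first exact: minS'.
by move=> S'' /asboolP; apply: minS'.
Qed.

Lemma not_mesh k C : ~ mesh k C -> exists Y Z S,
  [/\ Y \subset boundary C, Z \subset boundary C, k <= #|Y| & k <= #|Z|] /\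
  [/\ separator (hull_edges C Y Z) Y Z S, #|S| < k &
      forall S', separator (hull_edges C Y Z) Y Z S' -> #|S| <= #|S'|].
Proof.
move=> nm; apply: contrapT => none; apply: nm => Y Z S YX ZX kY kZ.
move=> /exists_minimum_separator[S' [sepS' S'S minS']].
rewrite leqNgt; apply/negP => Sk; apply: none; exists Y, Z, S'; split=> //.
by split=> //; apply: leq_ltn_trans Sk.
Qed.

Lemma exists_notin Y S : #|S| < #|Y| -> exists2 y, y \in Y & y \notin S.
Proof.
move=> SY; have /subsetPn[y yY yS] : ~~ (Y \subset S).
  by apply: contraL SY => /subset_leq_card; rewrite -leqNgt.
by exists y.
Qed.

(** The empty boundary is a case of its own because a premesh has its root in the boundary. *)
Definition small_premesh h C : Prop :=
  #|boundary C| <= h /\ (boundary C = set0 \/ exists F r, premesh C F r).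

(** While the boundary has fewer than [h] vertices, [Q] is a single vertex. Then [C] is not a mesh,
    and [Q] is the part in [C] of a minimum separator, with at most k - 1 vertices; hence the bag
    size. *)
Lemma small_premesh_step h k U C : 0 < h -> 0 < k ->
  (forall F r, premesh C F r -> mesh k C -> #|boundary C| < h) ->
  free_component U C -> small_premesh h C ->
  exists Q, [/\ Q \subset C, Q != set0, #|boundary C :|: Q| <= h + k.-1 &
    forall C', free_component (Q :|: U) C' -> C' \subset C -> small_premesh h C'].
Proof.
move=> h0 k0 nomesh compC [Xh pre].
have single u : u \in C -> #|boundary C| < h ->
    (forall C', free_component (u |: U) C' -> C' \subset C ->
      exists F' r', premesh C' F' r') ->
    exists Q, [/\ Q \subset C, Q != set0, #|boundary C :|: Q| <= h + k.-1 &
      forall C', free_component (Q :|: U) C' -> C' \subset C -> small_premesh h C'].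
  move=> uC Xlt preu; have uC1 : [set u] \subset C by rewrite sub1set.
  have Xu : #|boundary C :|: [set u]| <= h.
    apply: leq_trans (leq_card_setU _ _).1 _.
    by rewrite cards1 addn1.
  exists [set u]; split=> //.
  - by apply/set0Pn; exists u; rewrite set11.
  - exact: leq_trans Xu (leq_addr _ _).
  - move=> C' compC' C'C; split; last by right; apply: preu.
    apply: leq_trans Xu; apply: subset_leq_card.
    exact: refine_boundary compC compC' C'C.
have [X0|[F [r preF]]] := pre.
  have [/set0Pn[u uC] _ _ _] := compC; apply: (single u) => //.
    by rewrite X0 cards0.
  by move=> C'; apply: premesh_single compC X0 uC.
have [Xlt|hX] := ltnP #|boundary C| h.
  have /boundaryP[_ [u uC ru]] := premesh_root preF; apply: (single u) => //.
  by move=> C'; apply: premesh_add_vertex compC preF uC ru.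
have [] := @not_mesh k C.
  by move=> /(nomesh F r preF); rewrite ltnNge hX.
move=> Y [Z [S [[YX ZX kY kZ] [sepS Sk minS]]]].
have cC : connected C by case: compC.
have SY := leq_trans Sk kY; have SZ := leq_trans Sk kZ.
(* If [S] missed [C], the connected set [C] would join [Y] to [Z] outside [S]. *)
have Q0 : S :&: C != set0.
  rewrite setIC setI_eq0; apply/negP => CS.
  have [y yY yS] := exists_notin SY; have [z zZ zS] := exists_notin SZ.
  move/negP: (hull_through sepS (subxx C) cC CS yY yS (subsetP YX y yY) zZ zS).
  by apply; apply: (subsetP ZX).
exists (S :&: C); split=> //; first exact: subsetIr.
  apply: leq_trans (leq_card_setU _ _).1 (leq_add Xh _).
  rewrite -ltnS prednK //; apply: leq_ltn_trans Sk.
  by apply: subset_leq_card; apply: subsetIl.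
move=> C' compC' C'C; have cC' : connected C' by case: compC'.
have C'S : [disjoint C' & S].
  rewrite disjoint_subset; apply/subsetP => v vC'; rewrite inE.
  apply/negP => vS; move/negP: (refine_notinQ compC' vC'); apply.
  by rewrite inE vS (subsetP C'C).
have linked Y' Z' : Y' \subset boundary C -> #|S| < #|Y'| ->
    separator (hull_edges C Y' Z') Y' Z' S ->
    (forall S', separator (hull_edges C Y' Z') Y' Z' S' -> #|S| <= #|S'|) ->
    (forall y, y \in Y' -> y \notin S -> y \notin boundary C') ->
    small_premesh h C'.
  move=> Y'X SY' sepS' minS' noY; split.
    apply: leq_trans Xh; exact: linkedset_card compC Y'X compC' C'C noY SY'.
  right; exact: premesh_link compC preF Y'X compC' C'C Q0 sepS' minS' noY.
(* By [hull_through], [C'] cannot border both [Y] and [Z] outside [S]. The one it does not border is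
   linked to [S]; their roles can be exchanged. *)
have [/exists_inP[y yY /andP[yS yX']]|/exists_inPn noY] :=
    boolP [exists y in Y, (y \notin S) && (y \in boundary C')]; last first.
  apply: (linked Y Z) => // y yY yS.
  by have := noY y yY; rewrite yS.
apply: (linked Z Y) => //.
- exact: hull_separatorC.
- by move=> S' /hull_separatorC/minS.
- by move=> z zZ zS; apply: (hull_through sepS C'C cC' C'S yY yS yX').
Qed.

(* [h] boundary vertices are enough to cut the subcubic graph of a mesh into
   [k] pieces, and [2 k ^ 2 - 2 = h + k - 1]. *)
Lemma large_treewidth_kblock k : 0 < k ->
  (2 * k%:Z ^+ 2 - 2 <= treewidth G)%R ->
  exists H : sgraph, minor H G /\ exists X : {set H}, kblock k X.
Proof.
move=> k0 tw; apply: contrapT => noblock.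
(* The case k = 1 is separate, since [h] would be 0. There the hypothesis only says that [G] has a
   vertex, and [G] itself contains a 1-block. *)
have [k1|k2] := leqP k 1; last first.
  pose h := (2 * k + 1) * k.-1.
  have [] := @exists_decomposition G (h + k.-1) (small_premesh h).
  - move=> C /free_boundary; rewrite subset0 => /eqP X0.
    by split; [rewrite X0 cards0 | left].
  - move=> U C; apply: small_premesh_step => //.
      by rewrite /h; nia.
    (* Cutting a mesh takes (2k - 1)(k - 1) + k = 2k^2 - 2k + 1 boundary vertices, which is at most
       h = 2k^2 - k - 1 as soon as k is at least 2. *)
    move=> F r preF meshC; rewrite ltnNge; apply/negP => hX; apply: noblock.
    by apply: mesh_kblock preF meshC _ => //; apply: leq_trans hX; rewrite /h; nia.
  (* Bags of size at most 2k^2 - 2 make the width at most 2k^2 - 3. *)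
  move=> T [B [dB Bw]]; have := treewidth_le dB Bw.
  by rewrite /h; move: tw; rewrite expr2; nia.
have {k1} ek : k = 1 by apply/eqP; rewrite eqn_leq k1.
have [v _|G0] := pickP G; last first.
  have [||T [B [dB Bw]]] := @exists_decomposition G 0 (fun=> False).
  - by move=> C [/set0Pn[v]]; have := G0 v.
  - by [].
  by have := treewidth_le dB Bw; move: tw; rewrite ek; lia.
apply: noblock; exists G; split.
  exists (fun v => [set v]); split.
  - by move=> x; apply/set0Pn; exists x; rewrite set11.
  - by move=> x a b /set1P-> /set1P->; apply: connect0.
  - by move=> x y xy; rewrite disjoints1 inE.
  - by move=> x y xy; exists x, y; rewrite !set11.
have [|X] := @maxset_exists _ (inseparable k) [set v].
  rewrite /inseparable cards1 ek /=; apply/forall_inP => x /set1P->.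
  apply/forall_inP => y /set1P->; apply/forallP => S; apply/implyP => _.
  by rewrite /separates connect0 !andbF.
by move=> Xmax _; exists X.
Qed.

End Treewidth.

(** * Expanders have linear tree-width *)

Lemma drop_traject (A : Type) (f : A -> A) x i n :
  drop i (traject f x (i + n)) = traject f (iter i f x) n.
Proof. by elim: i x => [|i IHi] x; rewrite ?drop0 // addSn /= IHi -iterSr. Qed.

Section TreeOrientation.
Variable T : sgraph.

(** The two walks combine to a walk from [t'] to [t] that does not use the edge between them;
    shortened to a path, it closes with that edge to a cycle. *)
Lemma tree_bypass (s t t' : T) : acyclic T -> edge t t' ->
  connect (induced [set~ t]) t' s -> connect (induced [set~ t']) t s -> False.
Proof.
move=> acT tt' t's ts.
pose e : rel T := [rel x y | edge x y && ~~ (((x == t) && (y == t')) || ((x == t') && (y == t)))].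
have e_sym : symmetric e.
  move=> x y; rewrite /e /= edge_sym; congr (_ && ~~ _).
  by rewrite orbC [(x == t) && _]andbC [(x == t') && _]andbC.
have sub1 : subrel (connect (induced [set~ t])) (connect e).
  apply: connect_sub => x y /and3P[]; rewrite !inE => xt yt xy.
  by apply: connect1; rewrite /e /= xy (negPf xt) (negPf yt) andbF.
have sub2 : subrel (connect (induced [set~ t'])) (connect e).
  apply: connect_sub => x y /and3P[]; rewrite !inE => xt yt xy.
  by apply: connect1; rewrite /e /= xy (negPf xt) (negPf yt) andbF.
have : connect e t' t.
  by rewrite (connect_trans (sub1 _ _ t's)) // sym_connect_sym // sub2.
case/connectP => p0 pth0; case: (shortenP pth0) => p pth up _ lastp {p0 pth0}.
have epath : path (@edge T) t' p by apply: sub_path pth => x y /andP[].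
have : size (t' :: p) < 3.
  apply: acT; rewrite /ucycle up andbT /=.
  by rewrite rcons_path epath -lastp.
case: p pth lastp {up epath} => [|x [|y p]] //=.
  by move=> _ eqt; rewrite eqt edge_irrefl in tt'.
by move=> /andP[/andP[_ + _]] eqx _; rewrite eqx !eqxx orbT.
Qed.

(** Iterating [f] ends in a periodic orbit, a closed walk without repeated vertices. Acyclicity
    leaves the periods 1 and 2, and period 1 would be a loop. *)
Lemma tree_fixed_edge (f : T -> T) : is_tree T -> (forall t, edge t (f t)) ->
  exists t, f (f t) = t.
Proof.
case=> /card_gt0P[x _] _ acT ef.
have /trajectP[i lti eqi] := looping_order f x.
set n := order f x in lti eqi; pose y := iter i f x.
have [m nm] : exists m, n - i = m.+1.
  by exists (n - i).-1; rewrite prednK // subn_gt0.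
have ym : iter m.+1 f y = y by rewrite /y -iterD -nm subnK // ltnW.
have uy : uniq (traject f y m.+1).
  have := orbit_uniq f x; rewrite /orbit -/n -(subnKC (ltnW lti)) nm.
  by move/(drop_uniq i); rewrite drop_traject.
have : size (traject f y m.+1) < 3.
  apply: acT; rewrite /ucycle uy andbT trajectS /=.
  have -> : rcons (traject f (f y) m) y = traject f (f y) m.+1.
    by rewrite trajectSr -iterSr ym.
  by apply: sub_path (fpath_traject f y m.+1) => a b /eqP <-.
rewrite size_traject; case: m {nm uy} ym => [|[|m]] //= ym _; last by exists y.
by have := ef y; rewrite ym edge_irrefl.
Qed.

End TreeOrientation.

Section LargeTreewidth.
Variables (G T : sgraph) (B : T -> {set G}).
Hypothesis dB : tree_decomposition B.

(** The nodes whose bags meet a connected set form a connected part of [T]. It misses [t], so it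
    lies in one component of T - t, and [t'] is the neighbour of [t] there. *)
Lemma exists_direction (C : {set G}) t : connected C -> C != set0 ->
  [disjoint C & B t] -> exists t', edge t t' /\
    forall u s, u \in C -> u \in B s -> connect (induced [set~ t]) t' s.
Proof.
case: dB => -[_ cT _] cov cove conB cC /set0Pn[v vC] CB.
have inT u s s' : u \in C -> u \in B s -> u \in B s' ->
    connect (induced [set~ t]) s s'.
  move=> uC us us'; have := conB u s s'; rewrite !inE => /(_ us us').
  apply: connect_sub => a b /and3P[]; rewrite !inE => ua ub ab.
  have not_t x : u \in B x -> x != t.
    by apply: contraTneq => ->; rewrite (disjointFr CB uC).
  by apply: connect1; apply/and3P; rewrite !inE !not_t.
have [s0 vs0] := cov v.
pose P s := s = t \/ exists t', edge t t' /\ connect (induced [set~ t]) t' s.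
have [eqs|[t' [tt' ts0]]] : P s0.
  apply: (connect_step_ind (P := P)) (cT t s0 (in_setT _) (in_setT _)); first by left.
  move=> x y _ Px /and3P[_ _ xy]; case: (eqVneq y t) => [|yt]; first by left.
  right; case: (eqVneq x t) Px => [xt _|xt].
    by exists y; rewrite -{1}xt.
  case=> [/eqP|[t' [tt' tx]]]; first by rewrite (negPf xt).
  exists t'; split=> //; apply: connect_trans tx (connect1 _).
  by apply/and3P; rewrite !inE.
- by move: vs0; rewrite eqs (disjointFr CB vC).
exists t'; split=> // u s uC; move: s.
pose Q u := forall s, u \in B s -> connect (induced [set~ t]) t' s.
apply: (connect_step_ind (P := Q)) (cC v u vC uC).
  by move=> s vs; apply: connect_trans ts0 (inT v s0 s vC vs0 vs).
move=> x y _ Qx /and3P[xC yC /cove[s' /andP[xs' ys']]] s ys.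
exact: connect_trans (Qx s' xs') (inT y s' s yC ys' ys).
Qed.

(** Otherwise direct every node [t] towards a majority avoiding its bag. Some edge is directed both
    ways; its two majorities share a vertex, whose bags would have to lie on both sides of the
    edge. *)
Lemma exists_bag_without_majority :
  exists t, forall C : {set G}, connected C -> [disjoint C & B t] -> #|C|.*2 <= #|G|.
Proof.
apply: contrapT => none.
have /choice[C majC] : forall t, exists C : {set G},
    [/\ connected C, [disjoint C & B t] & #|G| < #|C|.*2].
  move=> t; apply: contrapT => noC; apply: none; exists t => C cC CB.
  by rewrite leqNgt; apply/negP => GC; apply: noC; exists C.
have /choice[f dirf] : forall t, exists t', edge t t' /\
    forall u s, u \in C t -> u \in B s -> connect (induced [set~ t]) t' s.
  move=> t; have [cC CB GC] := majC t; apply: exists_direction => //.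
  by apply: contraTneq GC => ->; rewrite cards0.
case: dB => treeT cov _ _.
have [t fft] := tree_fixed_edge treeT (fun t => (dirf t).1).
have [u] : exists u, u \in C t :&: C (f t).
  apply/set0Pn; rewrite -card_gt0; have [_ _ c1] := majC t; have [_ _ c2] := majC (f t).
  have := cardsUI (C t) (C (f t)); have := max_card (C t :|: C (f t)).
  by lia.
rewrite inE => /andP[ut uft]; have [s us] := cov u.
have [tft dt] := dirf t; have [_ dft] := dirf (f t).
case: treeT => _ _ acT; apply: (tree_bypass acT tft (dt u s ut us)).
by have := dft u s uft us; rewrite fft.
Qed.

End LargeTreewidth.

(** * Connected majorities in expanders *)

Section Expansion.
Variables (G : sgraph) (q : nat).
Hypothesis cardG : #|G| = 4 * q.
Hypothesis expG : forall A B : {set G}, q <= #|A| -> q <= #|B| ->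
  [disjoint A & B] -> exists u v, [/\ u \in A, v \in B & edge u v].

(** In other words, [A] is a union of components of G - S. *)
Definition closed_off (S A : {set G}) : bool :=
  (A \subset ~: S) && [forall u in A, forall v, (v \notin S) && edge u v ==> (v \in A)].

(** Take a smallest union [A] of components of G - S with at least [q] vertices. By expansion fewer
    than [q] vertices of G - S lie outside, so [A] has more than 4q - 2q. Were it disconnected, it
    would split into two smaller unions, each with fewer than [q] vertices. *)
Lemma exists_majority (S : {set G}) : 0 < q -> #|S| <= q ->
  exists C : {set G}, [/\ connected C, [disjoint C & S] & #|G| < #|C|.*2].
Proof.
move=> q0 Sq.
have offP A u v : closed_off S A -> u \in A -> v \notin S -> edge u v -> v \in A.
  case/andP=> _ /forall_inP clA uA vS uv.
  by have /forallP/(_ v)/implyP := clA u uA; rewrite vS; apply.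
have cS : #|~: S| = 4 * q - #|S| by rewrite cardsCs setCK cardG.
have PS : closed_off S (~: S) && (q <= #|~: S|).
  rewrite /closed_off subxx cS andTb; apply/andP; split; last by lia.
  by apply/forall_inP => u _; apply/forallP => v; rewrite inE; apply/implyP => /andP[].
case: (@arg_minnP _ _ (fun A => closed_off S A && (q <= #|A|)) (fun A => #|A|) PS).
move=> A /andP[offA qA] minA.
have AS : [disjoint A & S] by rewrite disjoints_subset; case/andP: offA.
have bigA : #|G| < #|A|.*2.
  have Bq : #|~: S :\: A| < q.
    rewrite ltnNge; apply/negP => qB.
    have [|u [v [uA]]] := expG qA qB.
      by rewrite -setI_eq0; apply/eqP/setP => v; rewrite !inE; case: (v \in A).
    by rewrite !inE => /andP[vA vS] uv; rewrite (offP A u v) in vA.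
  have := cardsID A (~: S); rewrite (setIidPr _); last by case/andP: offA.
  by lia.
exists A; split=> // x y xA yA; apply: contraT => nxy.
pose K := component (@edge G) A x.
have KA : K \subset A by apply: component_sub.
have xK : x \in K by apply: component_refl.
have yK : y \notin K by rewrite inE.
have Kclosed u v : u \in K -> v \in A -> edge u v -> v \in K.
  move=> uK vA uv; move: (uK); rewrite !inE => xu.
  by apply: connect_trans xu (connect1 _); apply/and3P; rewrite (subsetP KA).
have offK : closed_off S K.
  apply/andP; split; first by apply: subset_trans KA _; case/andP: offA.
  apply/forall_inP => u uK; apply/forallP => v; apply/implyP => /andP[vS uv].
  by apply: (Kclosed u) => //; apply: (offP A u) => //; apply: (subsetP KA).
have offD : closed_off S (A :\: K).
  apply/andP; split; first by apply: subset_trans (subsetDl _ _) _; case/andP: offA.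
  apply/forall_inP => u /setDP[uA uK]; apply/forallP => v; apply/implyP => /andP[vS uv].
  rewrite inE (offP A u v) // andbT; apply: contra uK => vK.
  by apply: (Kclosed v) => //; rewrite edge_sym.
have cK := cardsID K A; rewrite (setIidPr KA) in cK.
have K0 : 0 < #|K| by apply/card_gt0P; exists x.
have D0 : 0 < #|A :\: K| by apply/card_gt0P; exists y; rewrite inE yK.
have Kq : #|K| < q.
  by rewrite ltnNge; apply/negP => qK; have := minA K; rewrite offK qK => /(_ isT); lia.
have Dq : #|A :\: K| < q.
  by rewrite ltnNge; apply/negP => qD; have := minA (A :\: K); rewrite offD qD => /(_ isT); lia.
by lia.
Qed.

(** A bag with at most [q] vertices leaves a connected majority, so some bag is larger; this makes
    up for the 1 subtracted in the width. *)
Lemma expansion_treewidth : 0 < q -> (q%:Z <= treewidth G)%R.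
Proof.
move=> q0; rewrite /treewidth; case: ex_minnP => m /asboolP[T [B [dB Bm]]] _.
have [t noC] := exists_bag_without_majority dB.
suff : q < m by lia.
rewrite -Bm ltnNge; apply/negP => Bq.
have [|C [cC CB]] := @exists_majority (B t) q0.
  by apply: leq_trans (leq_bigmax t) Bq.
by rewrite ltnNge noC.
Qed.

End Expansion.

(** * Sparse expanders by counting *)

Section Counting.
Variable q : nat.
Hypothesis q0 : 0 < q.
Let m := 124 * q.
Local Notation V := 'I_(4 * q).
Local Notation sample := {ffun 'I_m -> V * V}.

Definition unlinked (A B : {set V}) : {set sample} :=
  [set f : sample | [forall i, f i \in ~: setX A B]].

(** Of the 16 q^2 possible arcs at least q^2 lead from [A] to [B]. *)
Lemma card_unlinked (A B : {set V}) : q <= #|A| -> q <= #|B| ->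
  #|unlinked A B| <= (15 * (q * q)) ^ m.
Proof.
move=> qA qB.
have -> : #|unlinked A B| = #|~: setX A B| ^ m.
  rewrite -[m in RHS]card_ord -card_ffun_on; apply: eq_card => f; rewrite inE.
  by apply/forallP/ffun_onP.
rewrite leq_exp2r ?muln_gt0 //.
have := cardsC (setX A B); rewrite cardsX card_prod !card_ord.
have : q * q <= #|A| * #|B| by apply: leq_mul.
by move: (#|A| * #|B|) => ab; lia.
Qed.

(* There are 4 ^ (4 * q) pairs of sets, a random arc avoids a given one with
   probability at most 15 / 16, and 124 = 4 * 31 with 4 * 15 ^ 31 < 16 ^ 31. *)
Lemma few_unlinked :
  2 ^ (4 * q) * 2 ^ (4 * q) * (15 * (q * q)) ^ m < (16 * (q * q)) ^ m.
Proof.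
rewrite (expnMn 15) (expnMn 16) mulnA ltn_pmul2r; last by rewrite expn_gt0 muln_gt0 q0.
rewrite -expnMn /m (_ : 124 * q = 31 * (4 * q)); last by lia.
rewrite !(expnM _ 31) -expnMn ltn_exp2r; last by rewrite muln_gt0.
lia.
Qed.

(** Union bound over all pairs of large sets. *)
Lemma exists_linked_sample : exists f : sample, forall A B : {set V},
  q <= #|A| -> q <= #|B| -> exists i, f i \in setX A B.
Proof.
pose big (P : {set V} * {set V}) := (q <= #|P.1|) && (q <= #|P.2|).
pose bad := \bigcup_(P | big P) unlinked P.1 P.2.
have cbad : #|bad| < #|{: sample}|.
  apply: leq_ltn_trans (_ : _ <= #|{: {set V} * {set V}}| * (15 * (q * q)) ^ m) _.
    apply: leq_trans (card_bigcup_leq (K := (15 * (q * q)) ^ m) _) _.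
      by move=> [A B] /andP[]; apply: card_unlinked.
    by rewrite leq_mul2r max_card orbT.
  rewrite card_ffun !card_prod !card_ord -!cardsT -!powersetT !card_powerset cardsT card_ord.
  by apply: leq_trans few_unlinked _; rewrite (_ : 16 * (q * q) = 4 * q * (4 * q)) //; lia.
have /subsetPn[f _ fbad] : ~~ ([set: sample] \subset bad).
  by apply: contraL cbad => /subset_leq_card; rewrite cardsT -leqNgt.
exists f => A B qA qB; apply: contrapT => nolink; move/negP: fbad; apply.
apply/bigcupP; exists (A, B); first exact/andP.
rewrite inE; apply/forallP => i; rewrite inE; apply/negP => fi.
by apply: nolink; exists i.
Qed.

(** Every edge counts twice, once in each direction. *)
Definition arcs (G : sgraph) : {set G * G} := [set e | edge e.1 e.2].

Lemma exists_expander : exists G : sgraph,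
  [/\ #|G| = 4 * q, #|arcs G| <= 248 * q &
    forall A B : {set G}, q <= #|A| -> q <= #|B| -> [disjoint A & B] ->
      exists u v, [/\ u \in A, v \in B & edge u v]].
Proof.
have [f linkf] := exists_linked_sample.
(* Loops of the sample are dropped; this does no harm, as only disjoint sets have to be joined. *)
pose e : rel V := [rel u v | (u != v) &&
  ([exists i, f i == (u, v)] || [exists i, f i == (v, u)])].
have e_sym : symmetric e by move=> u v; rewrite /e /= eq_sym orbC.
have e_irrefl : irreflexive e by move=> u; rewrite /e /= eqxx.
exists (SGraph e_sym e_irrefl); split; first by rewrite card_ord.
- have sub : arcs (SGraph e_sym e_irrefl) \subset
      (f @: setT) :|: [set ((f i).2, (f i).1) | i in [set: 'I_m]].
    apply/subsetP => -[u v]; rewrite inE => /andP[_ /orP[]] /existsP[i /eqP fi].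
      by rewrite in_setU -fi imset_f ?inE.
    rewrite in_setU; apply/orP; right; apply/imsetP; exists i; first by rewrite inE.
    by rewrite fi.
  apply: leq_trans (subset_leq_card sub) _; apply: leq_trans (leq_card_setU _ _).1 _.
  apply: leq_trans (leq_add (leq_imset_card _ _) (leq_imset_card _ _)) _.
  by rewrite cardsT card_ord /m; lia.
- move=> A B qA qB dAB; have [i] := linkf A B qA qB.
  case fi: (f i) => [u v]; rewrite inE => /andP[/= uA vB].
  exists u, v; split=> //; apply/andP; split.
    by apply: contraTneq vB => <-; rewrite (disjointFr dAB uA).
  by apply/orP; left; apply/existsP; exists i; rewrite fi.
Qed.

End Counting.

(** * Edges forced by a k-block in a minor *)

Section MinorArcs.
Variables H G : sgraph.

(** Choose for every arc of [H] an arc of [G] between the two branch sets; these are disjoint, so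
    the choice is injective. *)
Lemma minor_arcs : minor H G -> #|arcs H| <= #|arcs G|.
Proof.
case=> phi [phi0 cphi dphi ephi].
have phi_inj x y v : v \in phi x -> v \in phi y -> x = y.
  move=> vx vy; case: (eqVneq x y) => // /dphi dxy.
  by rewrite (disjointFr dxy vx) in vy.
have /choice[g gP] : forall a : H * H, exists b : G * G,
    edge a.1 a.2 -> [/\ b.1 \in phi a.1, b.2 \in phi a.2 & edge b.1 b.2].
  case=> x y; case: (boolP (edge x y)) => xy /=.
    by have [u [v uv]] := ephi x y xy; exists (u, v).
  (* A default value for pairs that are not edges. *)
  have [u _] := set0Pn _ (phi0 x); by exists (u, u).
have ginj : {in arcs H &, injective g}.
  move=> [x y] [x' y']; rewrite !inE => /(gP (x, y))[/= x1 y1 _] /(gP (x', y'))[/= x2 y2 _] eqg.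
  rewrite eqg in x1 y1.
  by rewrite (phi_inj _ _ _ x1 x2) (phi_inj _ _ _ y1 y2).
rewrite -(card_in_imset ginj); apply: subset_leq_card.
by apply/subsetP => _ /imsetP[a + ->]; rewrite !inE => /(gP a)[].
Qed.

(** With fewer than k - 1 neighbours of [x], some [y] in [X] is neither [x] nor a neighbour, and the
    neighbourhood of [x] would separate the two. *)
Lemma inseparable_degree k (X : {set H}) x : inseparable k X -> x \in X ->
  k.-1 <= #|[set y : H | edge x y]|.
Proof.
case/andP=> kX /forall_inP insX xX; set N := [set y | _].
rewrite leqNgt; apply/negP => Nk.
have [y yX yN] : exists2 y, y \in X & y \notin x |: N.
  apply: exists_notin; rewrite cardsU1; apply: leq_ltn_trans (leq_add (leq_b1 _) (leqnn _)) _.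
  by apply: leq_trans kX; lia.
move: yN; rewrite in_setU1 negb_or => /andP[yx yN].
have /forall_inP/(_ y yX)/forallP/(_ N)/implyP := insX x xX.
have Nk' : #|N| < k by lia.
move=> /(_ Nk')/negP; apply; rewrite /separates yN inE edge_irrefl /=.
apply/negP => xy.
have [|u [v [_ /set1P-> _ /and3P[_ + xv]]]] := connect_exit (set11 x) _ xy.
  by rewrite inE.
by rewrite !inE xv.
Qed.

Lemma kblock_arcs k (X : {set H}) : kblock k X -> k * k.-1 <= #|arcs H|.
Proof.
case/maxsetP => insX _; have /andP[kX _] := insX.
have -> : #|arcs H| = \sum_(x : H) #|[set y | edge x y]|.
  rewrite -sum1_card (eq_bigl (fun e => predT e.1 && edge e.1 e.2)); last first.
    by move=> e; rewrite inE.
  rewrite -(pair_big_dep predT (fun x y => edge x y) (fun _ _ => 1)) /=.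
  by apply: eq_bigr => x _; rewrite -sum1_card; apply: eq_bigl => y; rewrite inE.
apply: leq_trans (_ : \sum_(x in X) k.-1 <= _).
  by rewrite sum_nat_const leq_mul2r kX orbT.
rewrite [leqRHS](bigID (mem X)) /=; apply: leq_trans (leq_addr _ _).
by apply: leq_sum => x; apply: inseparable_degree.
Qed.

End MinorArcs.

(** * Both bounds together *)

Local Open Scope ring_scope.

Theorem theorem1p4 (R : realType) :
  (forall (k : nat) (G : sgraph),
     (1 <= k)%N -> 2 * k%:Z ^+ 2 - 2 <= treewidth G ->
     exists H : sgraph, minor H G /\ exists X : {set H}, kblock k X)
  /\
  (exists c : R, 0 < c /\
     exists k0 : nat, forall k : nat, (k0 <= k)%N ->
       exists G : sgraph, c * k%:R ^+ 2 <= (treewidth G)%:~R /\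
         forall H : sgraph, minor H G -> ~ exists X : {set H}, kblock k X).
Proof.
split; first by move=> k G; apply: large_treewidth_kblock.
(* With q the integer part of k^2 / 1000, the graph has at most 248 q arcs, fewer than the k (k - 1)
   that a k-block forces. As q is positive, k^2 < 1000 (q + 1) is at most 2000 q, hence the
   constant. *)
exists 2000%:R^-1; split; first by rewrite invr_gt0 ltr0n.
exists 100%N => k k100; pose q := (k * k %/ 1000)%N.
have q1 : (q * 1000 <= k * k)%N by apply: leq_trunc_div.
have q2 : (k * k < q.+1 * 1000)%N by rewrite ltn_ceil.
have q0 : (0 < q)%N by rewrite divn_gt0 //; nia.
have [G [cG arcsG expG]] := exists_expander q0.
exists G; split.
  have tw := expansion_treewidth cG expG q0.
  apply: le_trans (_ : q%:R <= _); last by rewrite -(ler_int R) in tw.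
  rewrite mulrC ler_pdivrMr ?ltr0n // -natrX -natrM ler_nat.
  by rewrite expnS expn1; lia.
move=> H HG [X /kblock_arcs]; rewrite leqNgt => /negP; apply.
apply: leq_ltn_trans (minor_arcs HG) _; apply: leq_ltn_trans arcsG _.
have kk : (k * k.-1 + k = k * k)%N by rewrite -mulnSr prednK //; apply: leq_trans k100.
have : (100 * k <= k * k)%N by rewrite leq_mul2r k100 orbT.
by move: q1 q0 kk; move: (k * k.-1)%N (k * k)%N => a b; lia.
Qed.
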